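(* Let $\mathbb F$ be $\mathbb R$ or $\mathbb C$, and let $I,J,K,R$ be positive integers such that $$2\leq I\leq J\leq K\leq R,\qquad R\leq \frac{I+J+2K-2-\sqrt{(I-J)^2+4K}}{2},$$ or equivalently $$m-1\leq I\leq J\leq K\leq R,\qquad R\leq (I+1-m)(J+1-m)+m-2,$$ where $m=R-K+2$. Then the CPD of an $I\times J\times K$ tensor of rank $R$ (over $\mathbb F$) is generically unique.
   Context: A tensor $\mathcal T\in\mathbb F^{I\times J\times K}$ is rank-1 if $\mathcal T=\mathbf a\circ\mathbf b\circ\mathbf c$ for nonzero vectors $\mathbf a\in\mathbb F^I$, $\mathbf b\in\mathbb F^J$, $\mathbf c\in\mathbb F^K$, where $\circ$ is the outer product, i.e. $t_{ijk}=a_ib_jc_k$. For matrices $\mathbf A=[\mathbf a_1\ \dots\ \mathbf a_R]\in\mathbb F^{I\times R}$, $\mathbf B=[\mathbf b_1\ \dots\ \mathbf b_R]\in\mathbb F^{J\times R}$, $\mathbf C=[\mathbf c_1\ \dots\ \mathbf c_R]\in\mathbb F^{K\times R}$ write $[\mathbf A,\mathbf B,\mathbf C]_R=\sum_{r=1}^R\mathbf a_r\circ\mathbf b_r\circ\mathbf c_r$. The rank of $\mathcal T$ is the minimal number of rank-1 tensors (over $\mathbb F$) whose sum is $\mathcal T$; a decomposition of $\mathcal T$ into this minimal number of rank-1 terms is called a canonical polyadic decomposition (CPD) of $\mathcal T$. The CPD of $\mathcal T$ is unique if it is only subject to permutation of the rank-1 terms and to rescaling of the vectors within a rank-1 term that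 leaves the term unchanged (i.e. the collection of rank-1 terms is uniquely determined up to order). Let $\mu_{\mathbb F}$ be the Lebesgue measure on $\mathbb F^{I\times R}\times\mathbb F^{J\times R}\times\mathbb F^{K\times R}$. The CPD of an $I\times J\times K$ tensor of rank $R$ is generically unique if $$\mu_{\mathbb F}\{(\mathbf A,\mathbf B,\mathbf C):\ \text{the CPD of the tensor } [\mathbf A,\mathbf B,\mathbf C]_R \text{ is not unique}\}=0.$$ *)

(* Defs.v *)
From HB Require Import structures.
From mathcomp Require Import all_boot all_order all_algebra.
From mathcomp Require Import all_classical all_reals all_analysis.
From mathcomp Require Import complex.

Set Implicit Arguments.
Unset Strict Implicit.
Unset Printing Implicit Defensive.
Import Order.TTheory GRing.Theory Num.Theory.

Local Open Scope classical_set_scope.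
Local Open Scope ring_scope.

Notation tensor F I J K := {ffun 'I_I * 'I_J * 'I_K -> F}.

Section tensor.
Variable F : fieldType.

Variables I J K : nat.
Implicit Types (T : tensor F I J K) (s : seq (tensor F I J K)).

Definition outer (a : 'cV[F]_I) (b : 'cV[F]_J) (c : 'cV[F]_K) : tensor F I J K :=
  [ffun x => a x.1.1 0 * b x.1.2 0 * c x.2 0].

Definition rank1 T : Prop :=
  exists a b c, [/\ a != 0, b != 0, c != 0 & T = outer a b c].

Definition polyadic_decomp T s : Prop :=
  (forall t, t \in s -> rank1 t) /\ T = \sum_(t <- s) t.

Lemma exists_polyadic_decomp T :
  exists n, `[< exists2 s, polyadic_decomp T s & size s = n >].
Proof.
pose X := [seq x <- enum {: 'I_I * 'I_J * 'I_K} | T x != 0].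
pose e x : tensor F I J K := outer (T x *: delta_mx x.1.1 0)
  (delta_mx x.1.2 0) (delta_mx x.2 0).
have dn0 p (i : 'I_p) : delta_mx i 0 != 0 :> 'cV[F]_p.
  by apply/eqP => /matrixP/(_ i 0)/eqP; rewrite !mxE !eqxx oner_eq0.
exists (size (map e X)); apply/asboolP; exists (map e X) => //; split.
  move=> t /mapP[x]; rewrite mem_filter => /andP[Tx0 _] ->.
  exists (T x *: delta_mx x.1.1 0), (delta_mx x.1.2 0), (delta_mx x.2 0).
  by rewrite scaler_eq0 negb_or Tx0 !dn0.
apply/ffunP => y; rewrite big_map sum_ffunE big_filter big_enum_cond/=.
have ey x : e x y = T x * (y == x)%:R.
  rewrite ffunE !mxE !eqxx !andbT -!mulrA -!natrM !mulnb andbA.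
  by case: x y => [[? ?] ?] [[? ?] ?].
have [Ty0|Ty0] := eqVneq (T y) 0.
  rewrite Ty0 big1// => x Tx0; rewrite ey.
  by case: (eqVneq y x) Tx0 => [<-|]; rewrite ?Ty0 ?eqxx ?mulr0.
rewrite (bigD1 y)//= ey eqxx mulr1 big1 ?addr0// => x /andP[_ xy].
by rewrite ey eq_sym (negbTE xy) mulr0.
Qed.

Definition tensor_rank T : nat := ex_minn (exists_polyadic_decomp T).

Definition is_cpd T s : Prop := polyadic_decomp T s /\ size s = tensor_rank T.

(* Terms are compared as tensors, so rescalings of the vectors inside a term
   that leave it unchanged are already identified; only the order remains. *)
Definition cpd_unique T : Prop :=
  forall s s', is_cpd T s -> is_cpd T s' -> perm_eq s s'.

Definition cpd_tensor r (A : 'M[F]_(I, r)) (B : 'M[F]_(J, r))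
    (C : 'M[F]_(K, r)) : tensor F I J K :=
  \sum_(q < r) outer (col q A) (col q B) (col q C).

Definition cpd_not_unique r :
    set ('M[F]_(I, r) * 'M[F]_(J, r) * 'M[F]_(K, r)) :=
  [set ABC | ~ cpd_unique (cpd_tensor ABC.1.1 ABC.1.2 ABC.2)].

End tensor.

Section sigma_finite.
Context d d' (T : measurableType d) (T' : measurableType d') (R : realType).

Lemma sigma_finite_pushforward (mu : set T -> \bar R) (f : T -> T')
    (g : T' -> T) : measurable_fun setT g -> cancel f g ->
  sigma_finite setT mu -> sigma_finite setT (pushforward mu f).
Proof.
move=> mg fK [S SE mS]; exists (fun k => g @^-1` S k).
  by apply/seteqP; split=> x// _; rewrite -preimage_bigcup -SE.
move=> k; split; first by rewrite -[X in measurable X]setTI; exact/mg/(mS k).1.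
rewrite /pushforward -comp_preimage (_ : g \o f = id) ?preimage_id; last first.
  by apply/funext => x; exact: fK.
exact: (mS k).2.
Qed.

(* The library's sigma-finite instance for [\x] is only found for
   subprobabilities. *)
Lemma sigma_finite_product (mu : {sigma_finite_measure set T -> \bar R})
    (nu : {sigma_finite_measure set T' -> \bar R}) :
  sigma_finite setT (mu \x nu)%E.
Proof.
have /sigma_finiteP[A [TA ndA Aoo]] := sigma_finiteT mu.
have /sigma_finiteP[B [TB ndB Boo]] := sigma_finiteT nu.
exists (fun n => A n `*` B n).
  rewrite -setXTT TA TB; apply/seteqP; split=> [[x y] [[n _ Anx] [k _ Bky]]|].
    exists (maxn n k) => //; split.
    - exact: (subsetPset _ _ (ndA _ _ (leq_maxl n k))).
    - exact: (subsetPset _ _ (ndB _ _ (leq_maxr n k))).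
  by move=> [x y] [n _ [? ?]]; split; exists n.
move=> k; have [? ?] := Aoo k; have [? ?] := Boo k.
split; first exact: measurableX.
by rewrite product_measure1E// lte_mul_pinfty// ge0_fin_numE.
Qed.

End sigma_finite.

Section tuple_power_measure.
Context d (T : measurableType d) (R : realType).
Variable mu : {sigma_finite_measure set T -> \bar R}.

Definition cons_pair n (x : T * n.-tuple T) : n.+1.-tuple T :=
  [tuple of x.1 :: x.2].

Let uncons n (t : n.+1.-tuple T) : T * n.-tuple T :=
  (thead t, [tuple of behead t]).

Let measurable_cons_pair n : measurable_fun setT (@cons_pair n).
Proof. exact: measurable_cons. Qed.

Let measurable_uncons n : measurable_fun setT (@uncons n).
Proof.
apply: measurable_fun_pair; last exact: measurable_behead.
exact: measurable_tnth.
Qed.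

Let cons_pairK n : cancel (@cons_pair n) (@uncons n).
Proof. by move=> [x t]; congr pair; exact: val_inj. Qed.

Definition cons_measure n (nu : {sigma_finite_measure set (n.-tuple T) -> \bar R}) :
    set (n.+1.-tuple T) -> \bar R :=
  pushforward (mu \x nu)%E (@cons_pair n).

HB.instance Definition _ n nu := Measure.copy (@cons_measure n nu)
  (measure_function_pushforward__canonical__measure_function_Measure
    (mu \x nu)%E (@measurable_cons_pair n)).
HB.instance Definition _ n nu := Measure_isSigmaFinite.Build _ _ _
  (@cons_measure n nu) 
    (sigma_finite_pushforward (@measurable_uncons n) (@cons_pairK n)
      (sigma_finite_product mu nu)).

Fixpoint tuple_power n : {sigma_finite_measure set (n.-tuple T) -> \bar R} :=
  if n is n'.+1 then cons_measure (tuple_power n') else \d_[tuple].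

Lemma tuple_power_box n (U : 'I_n -> set T) :
  (forall i, measurable (U i)) ->
  tuple_power n [set t | forall i, U i (tnth t i)] = (\prod_(i < n) mu (U i))%E.
Proof.
elim: n U => [|n IH] U mU.
  by rewrite big_ord0/= diracE mem_set// => -[].
rewrite big_ord_recl -IH//= /cons_measure /pushforward.
have mV : measurable [set t : n.-tuple T | forall i, U (lift ord0 i) (tnth t i)].
  rewrite [X in measurable X](_ : _ =
      \bigcap_(i in setT) ((@tnth _ T ^~ i) @^-1` U (lift ord0 i))).
    apply: fin_bigcap_measurable => // i _; rewrite -[X in measurable X]setTI.
    exact: measurable_tnth.
  by apply/seteqP; split=> [t Ut i _|t Ut i]; exact: Ut.
rewrite -product_measure1E//; congr (product_measure1 _ _ _).
apply/seteqP; split=> [[x t]/= Ux|[x t]/= [Ux Ut] i].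
  split; first exact: (Ux ord0).
  by move=> i; have := Ux (lift ord0 i); rewrite tnthS.
by case: (unliftP ord0 i) => [j ->|->//]; rewrite tnthS.
Qed.

End tuple_power_measure.

Definition measure_matrix_display : measure_display -> measure_display.
Proof. exact. Qed.

Section measurable_matrix.
Context d (T : measurableType d) (m n : nat).

(* Generators of the product sigma-algebra on the entries. *)
Definition mx_entry_preimages : set (set 'M[T]_(m, n)) :=
  [set [set M : 'M[T]_(m, n) | U (M ij.1 ij.2)] | ij in [set: 'I_m * 'I_n] & U in measurable].

Let mx_set0 : <<s mx_entry_preimages >> set0.
Proof. exact: sigma_algebra0. Qed.

Let mx_setC A : <<s mx_entry_preimages >> A -> <<s mx_entry_preimages >> (~` A).
Proof. exact: sigma_algebraC. Qed.

Let mx_bigcup (A : (set 'M[T]_(m, n))^nat) :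
  (forall i, <<s mx_entry_preimages >> (A i)) ->
  <<s mx_entry_preimages >> (\bigcup_i A i).
Proof. exact: sigma_algebra_bigcup. Qed.

HB.instance Definition _ := @isMeasurable.Build (measure_matrix_display d)
  'M[T]_(m, n) <<s mx_entry_preimages >> mx_set0 mx_setC mx_bigcup.

Definition mx_of_tuple (t : (m * n).-tuple T) : 'M[T]_(m, n) :=
  \matrix_(i, j) tnth t (mxvec_index i j).

Definition tuple_of_mx (M : 'M[T]_(m, n)) : (m * n).-tuple T :=
  [tuple mxvec M 0 k | k < m * n].

Lemma measurable_mx_of_tuple : measurable_fun setT mx_of_tuple.
Proof.
apply: measurability; first by [].
move=> _ [_ [ij _] [U mU] <-] <-.
have /(_ measurableT U mU) := @measurable_tnth _ T _ (mxvec_index ij.1 ij.2).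
by congr measurable; apply/seteqP; split=> t /=; rewrite mxE.
Qed.

Lemma measurable_tuple_of_mx : measurable_fun setT tuple_of_mx.
Proof.
apply/measurable_fun_tnthP => k _ U mU; rewrite setTI.
apply: sub_sigma_algebra; case: (mxvec_indexP k) => i j.
exists (i, j) => //; exists U => //; apply/seteqP; split=> M /=.
  by rewrite tnth_mktuple mxvecE.
by rewrite tnth_mktuple mxvecE.
Qed.

Lemma mx_of_tupleK : cancel mx_of_tuple tuple_of_mx.
Proof.
move=> t; apply: eq_from_tnth => k; rewrite tnth_mktuple.
by case: (mxvec_indexP k) => i j; rewrite mxvecE mxE.
Qed.

End measurable_matrix.

Section matrix_power_measure.
Context d (T : measurableType d) (R : realType).
Variables (mu : {sigma_finite_measure set T -> \bar R}) (m n : nat).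

Definition mx_power : set 'M[T]_(m, n) -> \bar R :=
  pushforward (tuple_power mu (m * n)) (@mx_of_tuple _ _ m n).

HB.instance Definition _ := Measure.copy mx_power
  (measure_function_pushforward__canonical__measure_function_Measure
    (tuple_power mu (m * n)) (@measurable_mx_of_tuple _ _ m n)).
HB.instance Definition _ := Measure_isSigmaFinite.Build _ _ _ mx_power
  (sigma_finite_pushforward (@measurable_tuple_of_mx _ _ m n)
    (@mx_of_tupleK _ _ m n) (sigma_finiteT _)).

(* The value on boxes, which characterizes the product measure. *)
Lemma mx_power_box (U : 'I_m -> 'I_n -> set T) :
  (forall i j, measurable (U i j)) ->
  mx_power [set M | forall i j, U i j (M i j)] =
  (\prod_(i < m) \prod_(j < n) mu (U i j))%E.
Proof.
move=> mU; pose p k := enum_val (cast_ord (esym (mxvec_cast m n)) k).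
have pE i j : p (mxvec_index i j) = (i, j) by rewrite /p cast_ordK enum_rankK.
have p_bij : bijective p.
  exists (fun ij => mxvec_index ij.1 ij.2) => [k|[i j]]; last exact: pE.
  by case: (mxvec_indexP k) => i j; rewrite pE.
rewrite pair_bigA/= (reindex p (onW_bij _ p_bij))/=.
rewrite -(tuple_power_box mu (U := fun k => U (p k).1 (p k).2))//.
congr (tuple_power mu (m * n) _); apply/seteqP; split=> t/= Ut.
  by move=> k; case: (mxvec_indexP k) => i j; have := Ut i j; rewrite pE mxE.
by move=> i j; have := Ut (mxvec_index i j); rewrite pE mxE.
Qed.

End matrix_power_measure.
Arguments mx_power {d T R} mu m n.

Section parameter_measure.
Local Open Scope ereal_scope.
Context d (T : measurableType d) (R : realType).
Variable mu : {sigma_finite_measure set T -> \bar R}.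

Definition factor_matrices_measure (I J K r : nat) :
    set ('M[T]_(I, r) * 'M[T]_(J, r) * 'M[T]_(K, r)) -> \bar R :=
  mx_power mu I r \x mx_power mu J r \x mx_power mu K r.

HB.instance Definition _ I J K r := Measure.on (@factor_matrices_measure I J K r).

End parameter_measure.
Arguments factor_matrices_measure {d T R} mu I J K r.

Section measurable_complex.
Variable R : realType.

HB.instance Definition _ := isPointed.Build R[i] 0.

Definition complex_pair (z : R[i]) : R * R := (complex.Re z, complex.Im z).
Definition pair_complex (p : R * R) : R[i] := Complex p.1 p.2.

HB.instance Definition _ :=
  Measurable.copy R[i] (g_sigma_algebra_preimageType complex_pair).

Lemma measurable_complex_pair : measurable_fun setT complex_pair.
Proof. by move=> _ B mB; exists B. Qed.

Lemma measurable_pair_complex : measurable_fun setT pair_complex.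
Proof.
move=> _ _ [B mB <-]; rewrite !setTI -comp_preimage.
by rewrite (_ : _ \o _ = id) ?preimage_id//; apply/funext => -[].
Qed.

Lemma pair_complexK : cancel pair_complex complex_pair.
Proof. by case. Qed.

Definition complex_lebesgue_measure : set R[i] -> \bar R :=
  pushforward (@lebesgue_measure R \x @lebesgue_measure R)%E pair_complex.

HB.instance Definition _ := Measure.copy complex_lebesgue_measure
  (measure_function_pushforward__canonical__measure_function_Measure
    (@lebesgue_measure R \x @lebesgue_measure R)%E measurable_pair_complex).
HB.instance Definition _ := Measure_isSigmaFinite.Build _ _ _
  complex_lebesgue_measure
  (sigma_finite_pushforward measurable_complex_pair pair_complexK
    (sigma_finite_product (@lebesgue_measure R) (@lebesgue_measure R))).

End measurable_complex.

(* Being Lebesgue-null is negligibility: inclusion in a Borel set of measure 0.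
   No measurability of the non-uniqueness set is presupposed. *)
Definition generically_unique_cpd_real (R : realType) (I J K r : nat) : Prop :=
  (factor_matrices_measure (@lebesgue_measure R) I J K r).-negligible
    (@cpd_not_unique R I J K r).

Definition generically_unique_cpd_complex (R : realType) (I J K r : nat) : Prop :=
  (factor_matrices_measure (@complex_lebesgue_measure R) I J K r).-negligible
    (@cpd_not_unique R[i] I J K r).

(* Main.v *)
Require Import Defs.
From mathcomp Require Import all_boot all_order all_algebra all_fingroup.
From mathcomp Require Import all_classical all_reals all_analysis.
From mathcomp Require Import complex measurable_realfun.
From mathcomp Require finmap.
From mathcomp Require Import zify ring lra.

(** Write [rho] for [r - K + 1] and, for [f] in the dual of [F^K], let [M f] be
    the contraction of the tensor with [f] in the third mode.  If
    [T = sum_q a_q o b_q o c_q], then [M f = sum_q <f, c_q> a_q b_q^T], a sum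
    with at most [rho] terms as soon as [f] kills [K - 1] columns of [C].  Both
    forms of the bound say that [rho < I] and [K <= (I - rho) * (J - rho)]: the
    projective space of the [f]'s, of dimension [K - 1], is smaller than the
    codimension of the [I x J] matrices of rank at most [rho].  Hence, for
    generic factors, the only [f <> 0] with [rank (M f) <= rho] should be the
    unavoidable ones, which kill [K - 1] columns of [C] (low_rank_trivial).

    This property, together with the general position of the columns of [A],
    [B] and [C], forces uniqueness.  Let a second decomposition of [T] with at
    most [r] terms have factors [A'], [B'], [C'].  If [f] kills [K - 1] columns
    of [C'], then [M f] has rank at most [rho], so [f] kills [K - 1] columns of
    [C]; by Kruskal's permutation lemma (kruskal_permutation) the columns of
    [C] and [C'] agree up to order and scaling.  Once the third factors are
    matched, the column spaces of the [M f] of rank [rho] give back the lines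
    spanned by the columns of [A] and of [B] (columns_on_lines), and then the
    scalars (weighted_terms_unique).

    Genericity is a dimension count made with polynomials.  Call a set of
    parameters thin if a nonzero polynomial function vanishes on it.  A set
    which is the image, under rational functions, of an affine space of smaller
    dimension is thin (thin_image): interpolating on a large grid produces more
    polynomials in the target coordinates than there are monomials of the
    corresponding degree in the source coordinates, so some nonzero combination
    vanishes on the image.  The parameters for which some unexpected [M f] has
    rank at most [rho] form finitely many such images (thin_low_rank_chart):
    the equation expressing all columns of [M f] through [rho] of them is linear
    in [I * (J - rho)] of the entries of [B], which are therefore determined by
    the remaining entries, by the [rho * (J - rho)] coefficients and by [f].

    Finally a thin set is Lebesgue-null, by Fubini's theorem and the finiteness
    of the set of roots of a polynomial in one variable (polynull_product);
    over the complex numbers it suffices to separate real and imaginary parts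
    (polyfun_complex). *)

Set Implicit Arguments.
Unset Strict Implicit.
Unset Printing Implicit Defensive.
Import Order.TTheory GRing.Theory Num.Theory.
Local Open Scope ring_scope.

(** * Polynomial functions and thin sets *)
Section PolyFun.
Variable F : numFieldType.

(** Polynomials are treated as functions, without normal forms: the only
    quantitative information needed about them is a degree bound on lines,
    and partial evaluation in some of the variables is again a composition. *)
Inductive polyfun (V : Type) : ((V -> F) -> F) -> Prop :=
| polyfun_cst c : polyfun (fun=> c)
| polyfun_var v : polyfun (fun x => x v)
| polyfun_add f g : polyfun f -> polyfun g -> polyfun (fun x => f x + g x)
| polyfun_mul f g : polyfun f -> polyfun g -> polyfun (fun x => f x * g x).

Lemma eq_polyfun V (f g : (V -> F) -> F) : f =1 g -> polyfun f -> polyfun g.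
Proof. by move=> /funext->. Qed.

Lemma polyfun_opp V (f : (V -> F) -> F) :
  polyfun f -> polyfun (fun x => - f x).
Proof.
move=> pf; apply: (@eq_polyfun _ (fun x => -1 * f x)) => [x|].
  by rewrite mulN1r.
exact: polyfun_mul (polyfun_cst _ _) pf.
Qed.

Lemma polyfun_sum V (T : Type) (s : seq T) (P : pred T)
    (f : T -> (V -> F) -> F) :
  (forall i, polyfun (f i)) -> polyfun (fun x => \sum_(i <- s | P i) f i x).
Proof.
move=> pf; elim: s => [|i s IH].
  by apply: eq_polyfun (polyfun_cst _ 0) => x; rewrite big_nil.
case Pi: (P i); last by apply: eq_polyfun IH => x; rewrite big_cons Pi.
by apply: eq_polyfun (polyfun_add (pf i) IH) => x; rewrite big_cons Pi.
Qed.

Lemma polyfun_prod V (T : Type) (s : seq T) (P : pred T)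
    (f : T -> (V -> F) -> F) :
  (forall i, polyfun (f i)) -> polyfun (fun x => \prod_(i <- s | P i) f i x).
Proof.
move=> pf; elim: s => [|i s IH].
  by apply: eq_polyfun (polyfun_cst _ 1) => x; rewrite big_nil.
case Pi: (P i); last by apply: eq_polyfun IH => x; rewrite big_cons Pi.
by apply: eq_polyfun (polyfun_mul (pf i) IH) => x; rewrite big_cons Pi.
Qed.

Lemma polyfun_comp V W (f : (V -> F) -> F) (g : V -> (W -> F) -> F) :
  polyfun f -> (forall v, polyfun (g v)) ->
  polyfun (fun y => f (fun v => g v y)).
Proof.
move=> pf pg; elim: pf => [c|v|f1 f2 _ IH1 _ IH2|f1 f2 _ IH1 _ IH2].
- exact: polyfun_cst.
- exact: pg.
- exact: polyfun_add.
- exact: polyfun_mul.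
Qed.

Definition polymx V m n (M : (V -> F) -> 'M[F]_(m, n)) :=
  forall i j, polyfun (fun x => M x i j).

Lemma polymx_mul V m n p (M : (V -> F) -> 'M[F]_(m, n))
    (N : (V -> F) -> 'M[F]_(n, p)) :
  polymx M -> polymx N -> polymx (fun x => M x *m N x).
Proof.
move=> pM pN i j.
apply: (@eq_polyfun _ (fun x => \sum_k M x i k * N x k j)) => [x|].
  by rewrite mxE.
by apply: polyfun_sum => k; exact: polyfun_mul.
Qed.

Lemma polyfun_det V n (M : (V -> F) -> 'M[F]_n) :
  polymx M -> polyfun (fun x => \det (M x)).
Proof.
move=> pM; apply: polyfun_sum => s; apply: polyfun_mul.
  exact: polyfun_cst.
by apply: polyfun_prod => i; exact: pM.
Qed.

Lemma polymx_adj V n (M : (V -> F) -> 'M[F]_n) :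
  polymx M -> polymx (fun x => \adj (M x)).
Proof.
move=> pM i j.
apply: (@eq_polyfun _ (fun x => cofactor (M x) j i)) => [x|].
  by rewrite mxE.
apply: polyfun_mul; first exact: polyfun_cst.
apply: polyfun_det => k l.
apply: (@eq_polyfun _ (fun x => M x (lift j k) (lift i l))) => [x|].
  by rewrite !mxE.
exact: pM.
Qed.

(** Bounding the degree of all restrictions to lines serves twice: along a
    coordinate axis it gives the degree in one variable, along the segment
    between two points it reduces statements to polynomials in one variable. *)
Definition deg_le V E (f : (V -> F) -> F) := forall x y,
  exists2 q : {poly F}, (size q <= E.+1)%N &
    forall t, f (fun v => x v + t * y v) = q.[t].

Lemma deg_le_mono V E E' (f : (V -> F) -> F) :
  (E <= E')%N -> deg_le E f -> deg_le E' f.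
Proof.
move=> EE' df x y; have [q sq qE] := df x y; exists q => //.
exact: leq_trans sq _.
Qed.

Lemma deg_le_cst V c : deg_le 0 (fun _ : V -> F => c).
Proof.
by move=> x y; exists c%:P => [|t]; [exact: size_polyC_leq1 | rewrite hornerC].
Qed.

Lemma deg_le_add V E (f g : (V -> F) -> F) :
  deg_le E f -> deg_le E g -> deg_le E (fun x => f x + g x).
Proof.
move=> df dg x y; have [p sp pE] := df x y; have [q sq qE] := dg x y.
exists (p + q) => [|t]; last by rewrite hornerD pE qE.
by rewrite (leq_trans (size_polyD _ _))// geq_max sp.
Qed.

Lemma deg_le_mul V E E' (f g : (V -> F) -> F) :
  deg_le E f -> deg_le E' g -> deg_le (E + E') (fun x => f x * g x).
Proof.
move=> df dg x y; have [p sp pE] := df x y; have [q sq qE] := dg x y.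
exists (p * q) => [|t]; last by rewrite hornerM pE qE.
rewrite (leq_trans (size_polyMleq _ _))//.
by move: sp sq; set a := size p; set b := size q; lia.
Qed.

Lemma deg_le_sum V E (T : Type) (s : seq T) (f : T -> (V -> F) -> F) :
  (forall i, deg_le E (f i)) -> deg_le E (fun x => \sum_(i <- s) f i x).
Proof.
move=> df; elim: s => [|i s IH].
  rewrite (_ : (fun=> _) = fun=> 0); last by apply/funext => x; rewrite big_nil.
  exact: deg_le_mono (deg_le_cst _).
rewrite (_ : (fun=> _) = fun x => f i x + \sum_(i <- s) f i x).
  exact: deg_le_add.
by apply/funext => x; rewrite big_cons.
Qed.

Lemma deg_le_prod V E (T : finType) (f : T -> (V -> F) -> F) :
  (forall i, deg_le E (f i)) -> deg_le (#|T| * E) (fun x => \prod_i f i x).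
Proof.
move=> df x y.
have /choice[q /all_and2[sq qE]] : forall i, exists q : {poly F},
    (size q <= E.+1)%N /\ forall t, f i (fun v => x v + t * y v) = q.[t].
  by move=> i; have [q] := df i x y; exists q.
exists (\prod_i q i) => [|t]; last first.
  by rewrite horner_prod; apply: eq_bigr => i _; rewrite qE.
rewrite (leq_trans (size_poly_prod_leq _ _))// leq_subLR addnS ltnS.
apply: (@leq_trans (\sum_(i : T) E.+1)); first exact: leq_sum.
by rewrite sum_nat_const mulnS.
Qed.

Lemma polyfun_deg V (f : (V -> F) -> F) :
  polyfun f -> exists E, deg_le E f.
Proof.
elim=> [c|v|g h _ [E gE] _ [E' hE']|g h _ [E gE] _ [E' hE']].
- by exists 0%N; exact: deg_le_cst.
- exists 1%N => x y; exists ((x v)%:P + y v *: 'X) => [|t]; last first.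
    by rewrite !hornerE mulrC.
  rewrite (leq_trans (size_polyD _ _))// geq_max.
  rewrite (leq_trans (size_polyC_leq1 _))//.
  by rewrite (leq_trans (size_scale_leq _ _))// size_polyX.
- exists (E + E')%N; apply: deg_le_add.
    by apply: deg_le_mono gE; rewrite leq_addr.
  by apply: deg_le_mono hE'; rewrite leq_addl.
- by exists (E + E')%N; exact: deg_le_mul.
Qed.

Lemma natf_uniq n : uniq [seq (i%:R : F) | i <- iota 0 n].
Proof.
have inj : injective (fun i : nat => i%:R : F).
  by move=> i j /eqP; rewrite eqr_nat => /eqP.
by rewrite (map_inj_uniq inj) iota_uniq.
Qed.

Lemma poly_nat_eq0 (q : {poly F}) n :
  (size q <= n)%N -> (forall i, (i < n)%N -> q.[i%:R] = 0) -> q = 0.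
Proof.
move=> sq q0; apply: (@roots_geq_poly_eq0 _ q [seq (i%:R : F) | i <- iota 0 n]).
- apply/allP => _ /mapP[i + ->]; rewrite mem_iota => /= i_n.
  exact/eqP/q0.
- exact: natf_uniq.
- by rewrite size_map size_iota.
Qed.

(** The coordinates are freed one at a time: along an axis the function is a
    polynomial of degree at most [E] with [E + 1] roots. *)
Lemma grid_vanish (W : finType) E (f : (W -> F) -> F) :
  deg_le E f ->
  (forall k : {ffun W -> 'I_E.+1}, f (fun w => (k w)%:R) = 0) ->
  forall x, f x = 0.
Proof.
move=> df f0 x.
suff H (s : seq W) : forall x,
    (forall w, w \notin s -> exists k : 'I_E.+1, x w = k%:R) -> f x = 0.
  by apply: (H (enum W)) => w; rewrite mem_enum.
elim: s => [|w0 s IH] {}x xs.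
  have /choice[k xk] : forall w, exists k : 'I_E.+1, x w = k%:R.
    by move=> w; exact: xs.
  rewrite -(f0 [ffun w => k w]); congr f; apply/funext => w.
  by rewrite ffunE.
pose x0 w := if w == w0 then 0 else x w.
have [q sq qE] := df x0 (fun w => (w == w0)%:R).
have xE t : (fun w => x0 w + t * (w == w0)%:R) =
    fun w => if w == w0 then t else x w.
  apply/funext => w; rewrite /x0; case: eqP => _; first by rewrite add0r mulr1.
  by rewrite mulr0 addr0.
suff q0 : q = 0.
  have := qE (x w0); rewrite q0 horner0 xE => <-; congr f.
  by apply/funext => w; case: eqP => [->|].
apply: (poly_nat_eq0 sq) => i iE; rewrite -qE xE; apply: IH => w ws.
case: (eqVneq w w0) => [_|ww0]; first by exists (Ordinal iE).
by apply: xs; rewrite inE negb_or ww0.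
Qed.

(** Subsets of proper algebraic hypersurfaces. *)
Definition thin V (X : (V -> F) -> Prop) := exists f,
  [/\ polyfun f, exists x, f x != 0 & forall x, X x -> f x = 0].

Lemma thin_sub V (X Y : (V -> F) -> Prop) :
  (forall x, X x -> Y x) -> thin Y -> thin X.
Proof. by move=> XY [f [pf nf f0]]; exists f; split=> // x /XY/f0. Qed.

Lemma thin0 V : @thin V (fun=> False).
Proof.
exists (fun=> 1); split=> //; first exact: polyfun_cst.
by exists (fun=> 0); exact: oner_neq0.
Qed.

(** The product of two nonzero polynomial functions is nonzero: restrict both
    to the line through a point where the first and a point where the second
    does not vanish. *)
Lemma thinU V (X Y : (V -> F) -> Prop) :
  thin X -> thin Y -> thin (fun x => X x \/ Y x).
Proof.
move=> [f [pf [x fx] f0]] [g [pg [y gy] g0]].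
exists (fun z => f z * g z); split; first exact: polyfun_mul.
- have [E /(_ x (fun v => y v - x v))[p _ pE]] := polyfun_deg pf.
  have [E' /(_ x (fun v => y v - x v))[q _ qE]] := polyfun_deg pg.
  pose z t v := x v + t * (y v - x v).
  have p0 : p != 0.
    apply: contraNneq fx => p0; have := pE 0; rewrite p0 horner0 => <-.
    by apply/eqP; congr f; apply/funext => v; rewrite mul0r addr0.
  have q0 : q != 0.
    apply: contraNneq gy => q0; have := qE 1; rewrite q0 horner0 => <-.
    by apply/eqP; congr g; apply/funext => v; rewrite mul1r addrC subrK.
  apply: contrapT => nz.
  suff /eqP : p * q = 0 by rewrite mulf_eq0 (negbTE p0) (negbTE q0).
  apply: (@poly_nat_eq0 _ (size (p * q))) => // i _.
  rewrite hornerM -pE -qE; apply: contrapT => /eqP nz'.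
  by apply: nz; exists (z i%:R).
- by move=> z [/f0->|/g0->]; rewrite ?mul0r ?mulr0.
Qed.

Lemma thin_bigU V (T : finType) (X : T -> (V -> F) -> Prop) :
  (forall i, thin (X i)) -> thin (fun x => exists i, X i x).
Proof.
move=> tX.
suff H (s : seq T) : thin (fun x => exists2 i, i \in s & X i x).
  by apply: thin_sub (H (enum T)) => x [i Xi]; exists i => //; rewrite mem_enum.
elim: s => [|i s IH]; first by apply: thin_sub (thin0 V) => x [].
apply: thin_sub (thinU (tX i) IH) => x [j]; rewrite inE => /orP[/eqP->|js Xj].
  by left.
by right; exists j.
Qed.

(** Fewer parameters than coordinates force an algebraic relation.  On the grid
    [{0, ..., D}^V] let [L k] be the Lagrange polynomial of the node [k], up to
    a factor.  Substituting [x v = p v / delta] and clearing denominators turns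
    [L k] into a polynomial [h k] on the parameter space, of degree [E']
    proportional to [D].  There are [(D + 1)^#|V|] functions [h k], while a
    function of degree at most [E'] is determined by its values on a grid with
    [(E' + 1)^#|W|] points.  For large [D] the [h k] are therefore linearly
    dependent, and the same combination of the [L k] is nonzero and vanishes
    on the image. *)
Lemma thin_image (V W : finType) (X : (V -> F) -> Prop)
    (delta : (W -> F) -> F) (p : V -> (W -> F) -> F) :
  (#|W| < #|V|)%N -> polyfun delta -> (forall v, polyfun (p v)) ->
  (forall x, X x ->
    exists2 y, delta y != 0 & forall v, x v * delta y = p v y) ->
  thin X.
Proof.
move=> WV pdelta pp Xp.
have [E dE pE] : exists2 E, deg_le E delta & forall v, deg_le E (p v).
  have [E0 dE0] := polyfun_deg pdelta.
  have /choice[E1 pE1] : forall v, exists E, deg_le E (p v).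
    by move=> v; exact: polyfun_deg.
  exists (maxn E0 (\max_v E1 v)).
    by apply: deg_le_mono dE0; rewrite leq_maxl.
  move=> v; apply: deg_le_mono (pE1 v).
  by rewrite leq_max (leq_bigmax v) orbT.
(* [E' + 1 <= (D + 1) * (n * E + 1)], so [D + 1 > (n * E + 1)^#|W|] makes the
   count work already when [#|V| = #|W| + 1] *)
pose n := #|V|; pose D := ((n * E).+1 ^ #|W|)%N; pose E' := (n * (D * E))%N.
pose L (k : {ffun V -> 'I_D.+1}) (x : V -> F) : F :=
  \prod_v \prod_(j < D) (x v - (lift (k v) j)%:R).
pose h (k : {ffun V -> 'I_D.+1}) (y : W -> F) : F :=
  \prod_v \prod_(j < D) (p v y - (lift (k v) j)%:R * delta y).
have hdeg k : deg_le E' (h k).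
  apply: deg_le_prod => v; rewrite -[X in (X * _)%N](card_ord D).
  apply: deg_le_prod => j; apply: deg_le_add => //.
  rewrite (_ : (fun=> _) = fun y => - (lift (k v) j)%:R * delta y); last first.
    by apply/funext => y; rewrite mulNr.
  exact: (deg_le_mul (deg_le_cst _) dE).
(* exactly [n * D] linear factors occur, whatever the node: this is what
   [lift (k v)], which skips the value [k v], is for *)
have hL k x y : delta y != 0 -> (forall v, x v * delta y = p v y) ->
    h k y = L k x * (delta y ^+ D) ^+ n.
  move=> d0 xy; rewrite /h /L -prodr_const -big_split/=; apply: eq_bigr => v _.
  have -> : delta y ^+ D = \prod_(j < D) delta y.
    by rewrite prodr_const card_ord.
  rewrite -big_split/=.
  by apply: eq_bigr => j _; rewrite mulrBl xy.
have LE (k k' : {ffun V -> 'I_D.+1}) :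
    (L k (fun v => (k' v)%:R) != 0) = (k == k').
  apply/idP/eqP => [|->].
    move/prodf_neq0 => Lk; apply/ffunP => v; apply/eqP; rewrite eq_sym.
    apply: contraT => kv; have := Lk v isT.
    case: (unliftP (k v) (k' v)) kv => [j ->|->]; last by rewrite eqxx.
    by rewrite (bigD1 j)//= subrr mul0r eqxx.
  apply/prodf_neq0 => v _; apply/prodf_neq0 => j _.
  by rewrite subr_eq0 eqr_nat neq_lift.
pose G := {ffun V -> 'I_D.+1}; pose H := {ffun W -> 'I_E'.+1}.
have HG : (#|H| < #|G|)%N.
  rewrite !card_ffun !card_ord.
  apply: (@leq_trans (D.+1 ^ #|W|.+1)); last by rewrite leq_pexp2l.
  rewrite expnSr; apply: (@leq_ltn_trans ((D.+1 * (n * E).+1) ^ #|W|)).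
    have [->|W0] := posnP #|W|; first by [].
    by rewrite leq_exp2r// /E'; nia.
  by rewrite expnMn ltn_pmul2l ?expn_gt0.
pose M : 'M[F]_(#|G|, #|H|) :=
  \matrix_(a, b) h (enum_val a : G) (fun w => ((enum_val b : H) w)%:R).
have /rowV0Pn[c /sub_kermxP cM c0] : kermx M != 0.
  rewrite -mxrank_eq0 mxrank_ker -lt0n subn_gt0.
  exact: leq_ltn_trans (rank_leq_col M) HG.
pose P x := \sum_a c 0 a * L (enum_val a : G) x.
exists P; split.
- apply: polyfun_sum => a; apply: polyfun_mul; first exact: polyfun_cst.
  apply: polyfun_prod => v; apply: polyfun_prod => j.
  apply: polyfun_add; first exact: polyfun_var.
  exact: polyfun_cst.
- have /rV0Pn[a ca] := c0.
  exists (fun v => ((enum_val a : G) v)%:R).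
  rewrite /P (bigD1 a)//= big1 ?addr0.
    by rewrite mulf_neq0// LE.
  move=> b ba; apply/eqP; rewrite mulf_eq0.
  rewrite -[_ == 0 :> F in X in _ || X]negbK LE.
  by rewrite (inj_eq enum_val_inj) ba orbT.
- move=> x /Xp[y dy xy].
  have hy : \sum_a c 0 a * h (enum_val a : G) y = 0.
    apply: (@grid_vanish _ E' (fun y => \sum_a c 0 a * h (enum_val a : G) y)).
      apply: deg_le_sum => a; exact: (deg_le_mul (deg_le_cst _) (hdeg _)).
    move=> k; have /rowP/(_ (enum_rank (k : H))) := cM; rewrite !mxE => cMk.
    by rewrite -[RHS]cMk; apply: eq_bigr => a _; rewrite mxE enum_rankK.
  have dn : (delta y ^+ D) ^+ n != 0 by rewrite !expf_neq0.
  apply: (mulIf dn); rewrite mul0r -[RHS]hy /P mulr_suml.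
  by apply: eq_bigr => a _; rewrite -mulrA -hL.
Qed.

End PolyFun.

(** * Columns in general position *)
Lemma exists_subset_card (T : finType) (Z W : {set T}) k :
  Z \subset W -> (#|Z| <= k <= #|W|)%N ->
  exists S : {set T}, [/\ Z \subset S, S \subset W & #|S| = k].
Proof.
move=> ZW /andP[Zk kW].
have [m mE] : exists m, (#|Z| + m = k)%N by exists (k - #|Z|)%N; rewrite subnKC.
elim: m Z ZW Zk mE => [|m IH] Z ZW Zk mE.
  by exists Z; split=> //; rewrite -mE addn0.
have /properP[_ [x xW xZ]] : Z \proper W by rewrite properEcard ZW; lia.
have xZE : #|x |: Z| = #|Z|.+1 by rewrite cardsU1 xZ.
have [|||S [xZS SW Sk]] := IH (x |: Z); rewrite ?xZE//; try lia.
  by rewrite finset.subUset finset.sub1set xW.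
exists S; split=> //.
by apply: fintype.subset_trans xZS; exact: finset.subsetUr.
Qed.

Section GeneralPosition.
Variable F : fieldType.

Lemma mul_subE m n p (u v : 'M[F]_(m, n)) (X : 'M[F]_(n, p)) i j :
  ((u - v) *m X) i j = (u *m X) i j - (v *m X) i j.
Proof. by rewrite mulmxBl [LHS]mxE [X in _ + X]mxE. Qed.

Lemma mul_scaleE m n p a (u : 'M[F]_(m, n)) (X : 'M[F]_(n, p)) i j :
  ((a *: u) *m X) i j = a * (u *m X) i j.
Proof. by rewrite -scalemxAl mxE. Qed.

Definition zeros n r (X : 'M[F]_(n, r)) (u : 'rV_n) : {set 'I_r} :=
  [set q | (u *m X) 0 q == 0].

(** For [n <= r] this says that any [n] columns of [X] are linearly
    independent.  Phrased with linear forms, it is used without spans. *)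
Definition general_position n r (X : 'M[F]_(n, r)) :=
  forall u : 'rV_n, u != 0 -> (#|zeros X u| < n)%N.

Lemma zerosP n r (X : 'M[F]_(n, r)) (u : 'rV_n) (Z : {set 'I_r}) q :
  Z \subset zeros X u -> q \in Z -> (u *m X) 0 q = 0.
Proof. by move=> /fintype.subsetP ZX /ZX; rewrite inE => /eqP. Qed.

Lemma exists_vanishing n r (X : 'M[F]_(n, r)) (Z : {set 'I_r}) :
  (#|Z| < n)%N -> exists2 u : 'rV_n, u != 0 & Z \subset zeros X u.
Proof.
move=> Zn; pose M : 'M[F]_(n, #|Z|) := colsub (@enum_val _ (mem Z)) X.
have /rowV0Pn[u /sub_kermxP uM u0] : kermx M != 0.
  rewrite -mxrank_eq0 mxrank_ker -lt0n subn_gt0.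
  exact: leq_ltn_trans (rank_leq_col M) Zn.
exists u => //; apply/fintype.subsetP => q qZ; rewrite inE.
have /rowP/(_ (enum_rank_in qZ q)) := uM; rewrite !mxE => uMq.
apply/eqP; rewrite -[RHS]uMq; apply: eq_bigr => i _.
by rewrite !mxE enum_rankK_in.
Qed.

Variables (n r : nat) (X : 'M[F]_(n, r)).
Hypotheses (nr : (n <= r)%N) (gpX : general_position X).

(** Enlarge [Z] to [n - 1] columns avoiding [e]: a nonzero form vanishing there
    cannot vanish at [e] as well, which would be an [n]-th zero. *)
Lemma exists_dual (Z : {set 'I_r}) e : (#|Z| < n)%N -> e \notin Z ->
  exists2 u : 'rV_n, Z \subset zeros X u & (u *m X) 0 e = 1.
Proof.
move=> Zn eZ; have [||S [ZS Se Sn]] := @exists_subset_card _ Z [set~ e] n.-1.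
- by rewrite finset.subsetC finset.sub1set inE.
- by rewrite cardsC1 card_ord; lia.
have eS : e \notin S by apply/negP => /(fintype.subsetP Se); rewrite !inE eqxx.
have [|u u0 Su] := @exists_vanishing _ _ X S; first by lia.
have ue : (u *m X) 0 e != 0.
  apply/negP => ue; have := gpX u0; rewrite ltnNge => /negP; apply.
  apply: (@leq_trans #|e |: S|); first by rewrite cardsU1 eS; lia.
  by apply: subset_leq_card; rewrite finset.subUset Su finset.sub1set inE ue.
exists (((u *m X) 0 e)^-1 *: u); last first.
  by rewrite -scalemxAl mxE mulVf.
apply/fintype.subsetP => q qZ; rewrite inE -scalemxAl mxE.
by rewrite (zerosP Su (fintype.subsetP ZS _ qZ)) mulr0.
Qed.

(** The dual form of the equality
    [span (Z + e) /\ span (Z + e') = span Z], valid while [#|Z| + 2 <= n]. *)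
Lemma vanishing_split (Z : {set 'I_r}) e e' (f : 'rV_n) :
  (#|Z|.+1 < n)%N -> e \notin Z -> e' \notin Z -> e != e' ->
  Z \subset zeros X f ->
  exists g h, [/\ f = g + h, e |: Z \subset zeros X g &
    e' |: Z \subset zeros X h].
Proof.
move=> Zn eZ e'Z ee' Zf.
have [||h0 e'h0 h0e] := @exists_dual (e' |: Z) e.
- by rewrite cardsU1 e'Z.
- by rewrite !inE negb_or ee'.
pose h := (f *m X) 0 e *: h0.
have hE q : (h *m X) 0 q = (f *m X) 0 e * (h0 *m X) 0 q.
  by rewrite mul_scaleE.
exists (f - h), h; rewrite subrK; split=> //; apply/fintype.subsetP => q.
  rewrite !inE mul_subE hE => /orP[/eqP->|qZ].
    by rewrite h0e mulr1 subrr.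
  by rewrite (zerosP Zf qZ) (zerosP e'h0) ?mulr0 ?subr0// !inE qZ orbT.
by move=> qe'; rewrite inE hE (zerosP e'h0 qe') mulr0.
Qed.

(** In dual terms: a vector lying in the span of every [rho] columns of [X]
    that include column [q] is a multiple of column [q]; the set of columns is
    shrunk one element at a time with vanishing_split. *)
Lemma vanishing_descent (Y : 'M[F]_(n, r)) q p rho : (0 < rho < n)%N ->
  (forall (Z : {set 'I_r}) (u : 'rV_n), q \in Z -> #|Z| = rho ->
    Z \subset zeros X u -> (u *m Y) 0 p = 0) ->
  forall u : 'rV_n, (u *m X) 0 q = 0 -> (u *m Y) 0 p = 0.
Proof.
move=> /andP[rho0 rhon] H.
suff K m (Z : {set 'I_r}) (u : 'rV_n) : q \in Z -> (#|Z| + m = rho)%N ->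
    Z \subset zeros X u -> (u *m Y) 0 p = 0.
  move=> u uq; apply: (K rho.-1 [set q]); rewrite ?inE ?cards1//; first by lia.
  by rewrite finset.sub1set inE uq.
elim: m Z u => [|m IH] Z u qZ mE Zu.
  by apply: (H Z) => //; rewrite -mE addn0.
have [e [e' [eZ e'Z ee']]] :
    exists e e', [/\ e \notin Z, e' \notin Z & e != e'].
  have /card_gt1P[e [e' []]] : (1 < #|~: Z|)%N.
    by have := cardsC Z; rewrite card_ord; lia.
  by rewrite !inE => eZ e'Z ee'; exists e, e'.
have [|g [h [-> gZ hZ]]] := vanishing_split _ eZ e'Z ee' Zu; first by lia.
rewrite mulmxDl mxE (IH (e |: Z) g) ?(IH (e' |: Z) h) ?addr0//.
- by rewrite !inE qZ orbT.
- by rewrite cardsU1 e'Z; lia.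
- by rewrite !inE qZ orbT.
- by rewrite cardsU1 eZ; lia.
Qed.

Lemma proportional_columns (Y : 'M[F]_(n, r)) q p : (0 < n)%N ->
  (forall u : 'rV_n, (u *m X) 0 q = 0 -> (u *m Y) 0 p = 0) ->
  exists l, forall u : 'rV_n, (u *m Y) 0 p = l * (u *m X) 0 q.
Proof.
move=> n0 H.
have [||h _ hq] := @exists_dual finset.set0 q; rewrite ?cards0 ?inE//.
exists ((h *m Y) 0 p) => u.
have := H (u - (u *m X) 0 q *: h).
rewrite !mul_subE !mul_scaleE hq mulr1 subrr.
by move=> /(_ erefl)/eqP; rewrite subr_eq0 mulrC => /eqP.
Qed.

End GeneralPosition.

Lemma mx_colE (F : fieldType) n r (Y : 'M[F]_(n, r)) i q :
  Y i q = ((delta_mx 0 i : 'rV_n) *m Y) 0 q.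
Proof. by rewrite -rowE mxE. Qed.

(** * Kruskal's permutation lemma *)
Section KruskalPermutation.
Variable F : fieldType.
Variables (K r : nat) (X Y : 'M[F]_(K, r)).
Hypotheses (K2 : (1 < K)%N) (Kr : (K <= r)%N).
Hypotheses (gpX : general_position X) (gpY : general_position Y).
Hypothesis XY : forall f : 'rV_K, f != 0 -> #|zeros X f| = K.-1 ->
  #|zeros Y f| = K.-1.

(* the columns of [Y] that lie in the span of the columns of [X] in [Z] *)
Let cl (Z : {set 'I_r}) : {set 'I_r} :=
  [set p | `[< forall f, Z \subset zeros X f -> (f *m Y) 0 p = 0 >]].

Let clP (Z : {set 'I_r}) p :
  reflect (forall f, Z \subset zeros X f -> (f *m Y) 0 p = 0) (p \in cl Z).
Proof. by rewrite inE; exact: asboolP. Qed.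

(** The hyperplane spanned by [K - 1] columns of [X] has a single equation
    [f], so its columns of [Y] are exactly the zeros of [f]. *)
Let cl_top (Z : {set 'I_r}) : #|Z| = K.-1 -> (K.-1 <= #|cl Z|)%N.
Proof.
move=> ZK; have [|f f0 Zf] := @exists_vanishing _ _ _ X Z; first by lia.
have Zf' : Z = zeros X f.
  by apply/eqP; rewrite eqEcard Zf ZK; have := gpX f0; lia.
rewrite -(XY f0); last by rewrite -Zf'.
apply: subset_leq_card; apply/fintype.subsetP => p; rewrite inE => /eqP fp.
apply/clP => g Zg.
have [e eZ] : exists e, e \notin Z.
  have /card_gt0P[e] : (0 < #|~: Z|)%N.
    by have := cardsC Z; rewrite card_ord; lia.
  by rewrite inE => eZ; exists e.
have fe : (f *m X) 0 e != 0 by move: eZ; rewrite Zf' inE.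
pose a := (g *m X) 0 e / (f *m X) 0 e.
have /eqP : g - a *: f = 0.
  apply: contrapT => /eqP /gpX; rewrite ltnNge => /negP; apply.
  apply: (@leq_trans #|e |: Z|); first by rewrite cardsU1 eZ; lia.
  apply: subset_leq_card; apply/fintype.subsetP => q.
  rewrite !inE mul_subE mul_scaleE => /orP[/eqP->|qZ].
    by rewrite /a divfK ?subrr.
  by rewrite (zerosP Zf qZ) (zerosP Zg qZ) mulr0 subrr.
by rewrite subr_eq0 => /eqP->; rewrite -scalemxAl mxE fp mulr0.
Qed.

(** Descending induction on [#|Z|].  When [e] ranges over the complement of
    [Z], the spans of [Z + e] meet pairwise in the span of [Z], so the sets of
    columns of [Y] that they contain outside the span of [Z] are disjoint.  Each
    has at least [#|Z| + 1 - #|cl Z|] elements by induction; if this number were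
    at least two for all [r - #|Z|] values of [e], there would not be enough
    columns. *)
Let card_cl m (Z : {set 'I_r}) : (0 < #|Z|)%N -> (#|Z| + m = K.-1)%N ->
  (#|Z| <= #|cl Z|)%N.
Proof.
elim: m Z => [|m IH] Z Z0 mE; first by rewrite addn0 in mE; rewrite mE cl_top.
rewrite leqNgt; apply/negP => clZ.
pose T e := cl (e |: Z) :\: cl Z.
have T_ge e : e \in ~: Z -> (#|Z| - #|cl Z| < #|T e|)%N.
  rewrite inE => eZ; have := IH (e |: Z); rewrite cardsU1 eZ => /(_ _ _)H.
  have {}H : (1 + #|Z| <= #|cl (e |: Z)|)%N by apply: H => //; lia.
  rewrite /T cardsD; have := subset_leq_card (subsetIr (cl (e |: Z)) (cl Z)).
  lia.
have T_disj e e' p : e \in ~: Z -> e' \in ~: Z -> p \in T e -> p \in T e' ->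
    e = e'.
  rewrite !inE => eZ e'Z /andP[pZ /asboolP pe] /andP[_ /asboolP pe'].
  apply: contrapT => /eqP ee'; move/negP: pZ; apply; apply/asboolP => f Zf.
  have [|g [h [-> gZ hZ]]] := vanishing_split Kr gpX _ eZ e'Z ee' Zf.
    by lia.
  by rewrite mulmxDl mxE pe// pe'// addr0.
have : (\sum_(e in ~: Z) #|T e| <= #|~: cl Z|)%N.
  under eq_bigr do rewrite -sum1_card.
  rewrite (exchange_big_dep (mem (~: cl Z)))/=; last first.
    by move=> e p _; rewrite !inE => /andP[].
  rewrite -sum1_card; apply: leq_sum => p _; rewrite sum1_card.
  apply/card_le1_eqP => e e'; rewrite !unfold_in => /andP[eZ pe] /andP[e'Z pe'].
  exact: (T_disj _ _ p).
apply/negP; rewrite -ltnNge.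
have : (\sum_(e in ~: Z) (#|Z| - #|cl Z|).+1 <= \sum_(e in ~: Z) #|T e|)%N.
  by apply: leq_sum => e; exact: T_ge.
rewrite sum_nat_const.
have := cardsC Z; have := cardsC (cl Z); rewrite !card_ord.
move: #|~: Z| #|~: cl Z| #|cl Z| #|Z| clZ mE Z0 (\sum_(e in ~: Z) #|T e|)%N.
move=> a b c z; nia.
Qed.

(** card_cl at singletons: each line spanned by a column of [X] contains a
    column of [Y]. *)
Lemma kruskal_permutation : exists (s : 'S_r) (l : 'I_r -> F),
  forall q, l q != 0 /\ forall f : 'rV_K, (f *m Y) 0 (s q) = l q * (f *m X) 0 q.
Proof.
have Yn0 p : exists f : 'rV_K, (f *m Y) 0 p != 0.
  have [||f _ fp] := @exists_dual _ _ _ _ Kr gpY finset.set0 p;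
    rewrite ?cards0 ?inE//.
    by lia.
  by exists f; rewrite fp oner_eq0.
have /choice[pl plE] : forall q, exists pl : 'I_r * F, pl.2 != 0 /\
    forall f : 'rV_K, (f *m Y) 0 pl.1 = pl.2 * (f *m X) 0 q.
  move=> q; have := @card_cl K.-2 [set q]; rewrite cards1 => /(_ isT).
  move=> Kc; have /card_gt0P[p /clP pq] := Kc ltac:(lia).
  have [||l lE] := @proportional_columns _ _ _ _ Kr gpX Y q p; first by lia.
    by move=> u uq; apply: pq; rewrite finset.sub1set inE uq.
  exists (p, l); split=> //=; have [f] := Yn0 p; rewrite lE.
  by apply: contraNneq => ->; rewrite mul0r.
have inj : injective (fun q => (pl q).1).
  move=> q q' qq'; apply: contrapT => /eqP qDq'.
  have [||f fq' fq] := @exists_dual _ _ _ _ Kr gpX [set q'] q.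
  - by rewrite cards1.
  - by rewrite inE.
  have := (plE q).2 f; rewrite fq mulr1 qq' (plE q').2.
  rewrite (zerosP fq') ?inE// mulr0 => /esym/eqP.
  by rewrite (negbTE (plE q).1).
by exists (perm inj), (fun q => (pl q).2) => q; rewrite permE; exact: plE.
Qed.

End KruskalPermutation.

(** * Uniqueness from the low-rank contractions *)
Section Pencil.
Variable F : fieldType.

(** The sum of the [d_q a_q b_q^T].  At [d = f *m C] it is the contraction
    with [f], in the third mode, of the tensor with factors [A], [B], [C]. *)
Definition wsum I J r (A : 'M[F]_(I, r)) (B : 'M[F]_(J, r)) (d : 'rV[F]_r) :
  'M[F]_(I, J) := A *m diag_mx d *m B^T.

Lemma wsumE I J r (A : 'M[F]_(I, r)) (B : 'M[F]_(J, r)) (d : 'rV[F]_r) i j :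
  wsum A B d i j = \sum_q A i q * d 0 q * B j q.
Proof.
by rewrite mxE; apply: eq_bigr => q _; rewrite mul_mx_diag !mxE.
Qed.

Lemma wsum_tr I J r (A : 'M[F]_(I, r)) (B : 'M[F]_(J, r)) (d : 'rV[F]_r) :
  (wsum A B d)^T = wsum B A d.
Proof. by rewrite /wsum !trmx_mul trmxK tr_diag_mx mulmxA. Qed.

Lemma wsum_mul I J r m n (A : 'M[F]_(I, r)) (B : 'M[F]_(J, r)) (d : 'rV[F]_r)
    (U : 'M[F]_(m, I)) (V : 'M[F]_(n, J)) :
  U *m wsum A B d *m V^T = wsum (U *m A) (V *m B) d.
Proof. by rewrite /wsum trmx_mul !mulmxA. Qed.

Definition supp r (d : 'rV[F]_r) : {set 'I_r} := [set q | d 0 q != 0].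

Lemma supp_mul n r (X : 'M[F]_(n, r)) u : supp (u *m X) = ~: zeros X u.
Proof. by apply/setP => q; rewrite !inE. Qed.

Lemma wsum_restrict I J r (A : 'M[F]_(I, r)) (B : 'M[F]_(J, r))
    (d : 'rV[F]_r) (e := @enum_val _ (mem (supp d))) :
  wsum A B d = colsub e A *m diag_mx (colsub e d) *m (colsub e B)^T.
Proof.
rewrite -/(wsum _ _ _); apply/matrixP => i j; rewrite !wsumE.
rewrite (bigID (mem (supp d)))/= [X in _ + X]big1 ?addr0.
  by rewrite big_enum_val; apply: eq_bigr => t _; rewrite !mxE.
by move=> q; rewrite !inE negbK => /eqP->; rewrite mulr0 mul0r.
Qed.

Lemma rank_wsum_le I J r (A : 'M[F]_(I, r)) (B : 'M[F]_(J, r)) d :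
  (\rank (wsum A B d) <= #|supp d|)%N.
Proof. rewrite wsum_restrict; exact: mulmx_max_rank. Qed.

Lemma exists_dual_mx n r (X : 'M[F]_(n, r)) (S : {set 'I_r}) :
  (n <= r)%N -> general_position X -> (#|S| <= n)%N ->
  exists U : 'M[F]_(#|S|, n), U *m colsub (@enum_val _ (mem S)) X = 1%:M.
Proof.
move=> nr gpX Sn.
have /choice[u uE] : forall t : 'I_#|S|, exists u : 'rV_n,
    S :\ enum_val t \subset zeros X u /\ (u *m X) 0 (enum_val t) = 1.
  move=> t; have tS := enum_valP t; have St := cardsD1 (enum_val t) S.
  rewrite tS in St.
  have [||u] := @exists_dual _ _ _ _ nr gpX (S :\ enum_val t) (enum_val t).
  - by lia.
  - by rewrite !inE eqxx.
  - by exists u.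
exists (\matrix_t u t); apply/matrixP => t t'.
have -> : (\matrix_t u t *m colsub (@enum_val _ (mem S)) X) t t' =
    (u t *m X) 0 (enum_val t').
  by rewrite !mxE; apply: eq_bigr => i _; rewrite !mxE.
rewrite [RHS]mxE; have [Su u1] := uE t; have [<-//|tt'] := eqVneq t t'.
rewrite (zerosP Su)// !inE enum_valP andbT (inj_eq enum_val_inj) eq_sym.
exact: tt'.
Qed.

(** Dual forms to the columns of [A] and of [B] in the support reduce the
    matrix to an invertible diagonal one. *)
Lemma rank_wsum I J r (A : 'M[F]_(I, r)) (B : 'M[F]_(J, r)) d :
  (I <= r)%N -> (J <= r)%N -> general_position A -> general_position B ->
  (#|supp d| <= I)%N -> (#|supp d| <= J)%N ->
  \rank (wsum A B d) = #|supp d|.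
Proof.
move=> Ir Jr gpA gpB SI SJ; apply/eqP; rewrite eqn_leq rank_wsum_le/=.
have [U UA] := exists_dual_mx Ir gpA SI.
have [V VB] := exists_dual_mx Jr gpB SJ.
rewrite wsum_restrict; set e := @enum_val _ _.
pose D := diag_mx (colsub e d).
have UMV : U *m (colsub e A *m D *m (colsub e B)^T) *m V^T = D.
  by rewrite !mulmxA UA mul1mx -mulmxA -trmx_mul VB trmx1 mulmx1.
have Du : D \in unitmx.
  rewrite unitmxE det_diag unitfE; apply/prodf_neq0 => t _; rewrite mxE.
  by have := enum_valP t; rewrite inE.
apply: (@leq_trans (\rank D)); first by rewrite (mxrank_unit Du).
rewrite -[X in (\rank X <= _)%N]UMV.
exact: leq_trans (mxrankM_maxl _ _) (mxrankM_maxr _ _).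
Qed.

(** Choose [f] such that [f *m C] has support a given set [S] of [rho] columns
    containing [q].  The contraction has rank [rho], so the columns of [B'] in
    [S] are independent, and a form killing the columns of [A] in [S] kills
    those of [A'].  As [rho < I], letting [S] vary and using
    vanishing_descent leaves only the line of column [q]. *)
Lemma columns_on_lines I J K r (A A' : 'M[F]_(I, r)) (B B' : 'M[F]_(J, r))
    (C : 'M[F]_(K, r)) :
  (1 < K <= r)%N -> (r - K < I.-1)%N -> (r - K < J)%N ->
  (I <= r)%N -> (J <= r)%N ->
  general_position A -> general_position B -> general_position C ->
  (forall f, wsum A B (f *m C) = wsum A' B' (f *m C)) ->
  forall q, exists l, forall u : 'rV_I, (u *m A') 0 q = l * (u *m A) 0 q.
Proof.
move=> /andP[K1 Kr] rI rJ Ir Jr gpA gpB gpC AB q.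
apply: (proportional_columns Ir gpA); first by lia.
apply: (vanishing_descent Ir gpA (rho := (r - K).+1)); first by lia.
move=> S u qS Sr Su.
have SC : (#|~: S| = K.-1)%N by have := cardsC S; rewrite card_ord; lia.
have [|f f0 Sf] := @exists_vanishing _ _ _ C (~: S); first by lia.
have Sf' : supp (f *m C) = S.
  rewrite supp_mul; apply/eqP.
  rewrite -(inj_eq (@finset.setC_inj _)) finset.setCK eq_sym.
  by rewrite eqEcard Sf SC; have := gpC f f0; lia.
(* this is where the ranks force the columns of [B'] in [S] to be free *)
have rk : \rank (wsum A B (f *m C)) = #|supp (f *m C)|.
  by apply: rank_wsum => //; rewrite Sf'; lia.
have uM : u *m wsum A B (f *m C) = 0.
  apply/rowP => j; rewrite -[wsum A B _]mulmx1 -[1%:M]trmx1 mulmxA wsum_mul.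
  rewrite wsumE mxE big1// => p _; have [pS|pS] := boolP (p \in S).
    by rewrite (zerosP Su pS) !mul0r.
  by rewrite (zerosP Sf) ?inE// mulr0 mul0r.
rewrite AB in uM; rewrite AB in rk.
have := wsum_restrict A' B' (f *m C); set e := @enum_val _ _ => ME.
have /row_freeP[V QV] : row_free (colsub e B')^T.
  rewrite /row_free eqn_leq rank_leq_row/= -[X in (X <= _)%N]rk ME.
  exact: mxrankM_maxr.
have := congr1 (mulmx^~ V) uM.
rewrite ME mul0mx -!mulmxA QV mulmx1.
have qS' : q \in supp (f *m C) by rewrite Sf'.
have eq : e (enum_rank_in qS' q) = q by exact: enum_rankK_in.
have uA' x : (u *m colsub e A') 0 x = (u *m A') 0 (e x).
  by rewrite !mxE; apply: eq_bigr => t _; rewrite !mxE.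
move=> /rowP/(_ (enum_rank_in qS' q)).
rewrite mulmxA mul_mx_diag [LHS]mxE uA' [X in _ * X = _]mxE eq [RHS]mxE.
move=> /eqP; rewrite mulf_eq0 => /orP[/eqP //|].
by have := qS'; rewrite inE => /negbTE->.
Qed.

(** Both vectors of a term are known up to scalars; pairing with forms dual to
    [q] within a set of [rho] columns shows that these scalars have product
    one. *)
Lemma weighted_terms_unique I J K r (A A' : 'M[F]_(I, r))
    (B B' : 'M[F]_(J, r)) (C : 'M[F]_(K, r)) :
  (1 < K <= r)%N -> (r - K < I.-1)%N -> (r - K < J.-1)%N ->
  (I <= r)%N -> (J <= r)%N ->
  general_position A -> general_position B -> general_position C ->
  (forall f, wsum A B (f *m C) = wsum A' B' (f *m C)) ->
  forall q i j, A' i q * B' j q = A i q * B j q.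
Proof.
move=> Kr rI rJ Ir Jr gpA gpB gpC AB q i j; have /andP[K1 K_r] := Kr.
have [rI' rJ'] : (r - K < I)%N /\ (r - K < J)%N by lia.
have /choice[a aE] := columns_on_lines Kr rI rJ' Ir Jr gpA gpB gpC AB.
have BA f : wsum B A (f *m C) = wsum B' A' (f *m C).
  by rewrite -wsum_tr AB wsum_tr.
have /choice[b bE] := columns_on_lines Kr rJ rI' Jr Ir gpB gpA gpC BA.
rewrite mx_colE aE [B' j q]mx_colE bE -!mx_colE mulrACA.
suff -> : a q * b q = 1 by rewrite mul1r.
have [||S [qS _ Sr]] :=
    @exists_subset_card _ [set q] [set: 'I_r] (r - K).+1.
- exact: finset.subsetT.
- by rewrite cards1 cardsT card_ord; lia.
rewrite finset.sub1set in qS.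
have SC : (#|~: S| = K.-1)%N by have := cardsC S; rewrite card_ord; lia.
have [|f f0 Sf] := @exists_vanishing _ _ _ C (~: S).
  by rewrite SC; lia.
have fq : (f *m C) 0 q != 0.
  apply/negP => fq; have := gpC f f0; rewrite ltnNge => /negP; apply.
  apply: (@leq_trans #|q |: ~: S|).
    by rewrite cardsU1 inE qS SC; lia.
  by apply: subset_leq_card; rewrite finset.subUset Sf finset.sub1set inE fq.
have cSq : (#|S :\ q| = r - K)%N.
  by move: (cardsD1 q S); rewrite qS Sr add1n => -[].
have [||u Su uq] := @exists_dual _ _ _ _ Ir gpA (S :\ q) q.
- by rewrite cSq; lia.
- by rewrite !inE eqxx.
have [||v Sv vq] := @exists_dual _ _ _ _ Jr gpB (S :\ q) q.
- by rewrite cSq; lia.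
- by rewrite !inE eqxx.
have := congr1 (fun M => (u *m M *m v^T) 0 0) (AB f).
rewrite /= !wsum_mul !wsumE.
rewrite (bigD1 q)//= uq vq mul1r mulr1 big1 ?addr0; last first.
  move=> p pq; have [pS|pS] := boolP (p \in S).
    by rewrite (zerosP Su) ?mul0r// !inE pq.
  by rewrite (zerosP Sf) ?inE// mulr0 mul0r.
rewrite (bigD1 q)//= aE bE uq vq !mulr1 big1 ?addr0; last first.
  move=> p pq; rewrite aE bE; have [pS|pS] := boolP (p \in S).
    by rewrite (zerosP Su) ?mulr0 ?mul0r// !inE pq.
  by rewrite (zerosP Sf) ?inE// mulr0 mul0r.
by rewrite mulrAC => /esym/(canRL (mulfK fq)) ->; rewrite mulfV.
Qed.

(** The converse inequality [rho <= #|supp (f *m C)|] holds for all nonzero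
    [f] when [C] is in general position, so this describes the contractions
    of rank at most [rho] completely. *)
Definition low_rank_trivial I J K r (A : 'M[F]_(I, r)) (B : 'M[F]_(J, r))
    (C : 'M[F]_(K, r)) :=
  forall f : 'rV_K, f != 0 -> (\rank (wsum A B (f *m C)) <= (r - K).+1)%N ->
    (#|supp (f *m C)| <= (r - K).+1)%N.

(** [A'], [B'], [C'] may have zero columns, so that shorter decompositions,
    padded with zero terms, are covered.  Every contraction by [f <> 0] has rank
    at least [rho]; this puts the columns of [C'] in general position, and
    kruskal_permutation applies. *)
Lemma terms_unique I J K r (A A' : 'M[F]_(I, r)) (B B' : 'M[F]_(J, r))
    (C C' : 'M[F]_(K, r)) :
  (1 < K <= r)%N -> (r - K < I.-1)%N -> (r - K < J.-1)%N ->
  (I <= r)%N -> (J <= r)%N ->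
  general_position A -> general_position B -> general_position C ->
  low_rank_trivial A B C ->
  (forall f, wsum A B (f *m C) = wsum A' B' (f *m C')) ->
  exists s : 'S_r, forall q i j k,
    A' i q * B' j q * C' k q = A i (s q) * B j (s q) * C k (s q).
Proof.
move=> K1r rI rJ Ir Jr gpA gpB gpC lrt AB; have /andP[K1 Kr] := K1r.
have zs (X : 'M[F]_(K, r)) f : (#|zeros X f| + #|supp (f *m X)| = r)%N.
  by rewrite supp_mul cardsC card_ord.
have rk_ge f : f != 0 -> ((r - K).+1 <= \rank (wsum A B (f *m C)))%N.
  move=> f0; rewrite leqNgt; apply/negP => rk.
  have sf := lrt f f0 (ltnW rk); move: rk; rewrite rank_wsum//; try lia.
  by have := zs C f; have := gpC f f0; lia.
have gpC' : general_position C'.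
  move=> f f0; have := rk_ge f f0; rewrite AB => /leq_trans.
  by move=> /(_ _ (rank_wsum_le A' B' (f *m C'))); have := zs C' f; lia.
have [|s [l sl]] := kruskal_permutation K1 Kr gpC' gpC.
  move=> f f0 zf; have := lrt f f0; rewrite AB.
  have := rank_wsum_le A' B' (f *m C'); have := zs C' f; have := zs C f.
  by have := gpC f f0; lia.
(* reorder the second decomposition and move its scalars to the first factor,
   so that it has the third factor [C] *)
pose A2 := \matrix_(i, p) (A' i ((s^-1)%g p) / l ((s^-1)%g p)).
pose B2 := \matrix_(j, p) (B' j ((s^-1)%g p)).
have AB2 f : wsum A B (f *m C) = wsum A2 B2 (f *m C).
  rewrite AB; apply/matrixP => i j; rewrite !wsumE.
  rewrite [RHS](reindex_inj (@perm_inj _ s)); apply: eq_bigr => q _.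
  have [lq ->] := sl q; rewrite [A2 _ _]mxE [B2 _ _]mxE permK.
  by rewrite [_ / _ * _]mulrA divfK.
exists s => q i j k; have [lq slq] := sl q.
have := weighted_terms_unique K1r rI rJ Ir Jr gpA gpB gpC AB2 (s q) i j.
rewrite [A2 _ _]mxE [B2 _ _]mxE permK => <-.
rewrite [C k (s q)]mx_colE slq -mx_colE; field; exact: lq.
Qed.

End Pencil.

(** * Degenerate parameters form a thin set *)
Lemma exists_injection (T : finType) (S : {set T}) n : (n <= #|S|)%N ->
  exists2 s : {ffun 'I_n -> T}, injective s & forall t, s t \in S.
Proof.
move=> nS; exists [ffun t => enum_val (widen_ord nS t)] => [t t'|t].
  by rewrite !ffunE => /enum_val_inj/(congr1 val)/= tt'; exact: val_inj.
by rewrite ffunE enum_valP.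
Qed.

Lemma rank_column_basis (F : fieldType) m n (M : 'M[F]_(m, n)) :
  exists2 s : {ffun 'I_(\rank M) -> 'I_n}, injective s &
    exists N, M = colsub s M *m N.
Proof.
rewrite -mxrank_tr; exists [ffun t => maxrankfun M^T t].
  by move=> t t'; rewrite !ffunE => /maxrankfun_inj.
have /submxP[D MD] : (M^T <= rowsub (maxrankfun M^T) M^T)%MS.
  by rewrite eq_maxrowsub.
exists D^T; apply: trmx_inj; rewrite trmx_mul trmxK [LHS]MD; congr (_ *m _).
by apply/matrixP => i j; rewrite !mxE ffunE.
Qed.

Section Genericity.
Variable F : numFieldType.

Lemma general_position_unit n r (X : 'M[F]_(n, r)) (s : 'I_n -> 'I_r) :
  general_position X -> injective s -> \det (colsub s X) != 0.
Proof.
move=> gpX injs; apply/negP => /det0P[u u0 uX].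
have := gpX u u0; rewrite ltnNge => /negP; apply.
rewrite -[X in (X <= _)%N](card_ord n) -(card_codom injs).
apply: subset_leq_card; apply/fintype.subsetP => _ /codomP[t ->].
rewrite inE; have /rowP/(_ t) := uX; rewrite !mxE => uXt.
by apply/eqP; rewrite -[RHS]uXt; apply: eq_bigr => i _; rewrite !mxE.
Qed.

Lemma thin_not_general_position (V : Type) n r (M : (V -> F) -> 'M[F]_(n, r)) :
  polymx M -> (forall X, exists x, M x = X) ->
  thin (fun x => ~ general_position (M x)).
Proof.
move=> pM surM.
apply: (@thin_sub _ _ _ (fun x => exists s : {ffun 'I_n -> 'I_r},
    injective s /\ \det (colsub s (M x)) = 0)).
  move=> x ngp; apply: contrapT => H; apply: ngp => u u0.
  rewrite ltnNge; apply/negP => /exists_injection[s injs zs]; apply: H.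
  exists s; split=> //; apply/eqP/det0P; exists u => //.
  apply/rowP => t; have := zs t; rewrite inE => /eqP; rewrite !mxE => uXt.
  by rewrite -[RHS]uXt; apply: eq_bigr => i _; rewrite !mxE.
apply: thin_bigU => s; have [injs|ninjs] := pselect (injective s); last first.
  by apply: thin_sub (thin0 F V) => x [].
exists (fun x => \det (colsub s (M x))); split.
- apply: polyfun_det => i j.
  by apply: eq_polyfun (pM i (s j)) => x; rewrite !mxE.
- have [x xE] := surM (\matrix_(i, q) (q == s i)%:R); exists x.
  rewrite xE [X in \det X](_ : _ = 1%:M) ?det1 ?oner_eq0//.
  by apply/matrixP => i j; rewrite !mxE (inj_eq injs) eq_sym.
- by move=> x [].
Qed.

(** A way to use thin_image: if, given auxiliary parameters [z], the
    coordinates in [E] are rational functions of the others and of [z], and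
    there are fewer auxiliary parameters than eliminated coordinates, then the
    set is thin.  The functions are allowed to read all coordinates, those in
    [E] being masked by zero. *)
Lemma thin_elimination (V Z : finType) (E : {set V}) (X : (V -> F) -> Prop)
    (delta : (V + Z -> F) -> F) (p : V -> (V + Z -> F) -> F) :
  (#|Z| < #|E|)%N -> polyfun delta -> (forall v, polyfun (p v)) ->
  (forall x, X x -> exists z : Z -> F,
    let y u := match u with
               | inl v => if v \in E then 0 else x v
               | inr a => z a
               end in
    delta y != 0 /\ forall v, v \in E -> x v * delta y = p v y) ->
  thin X.
Proof.
move=> ZE pdelta pp HX.
pose W : finType := ({v | v \notin E} + Z)%type.
pose ext (w : W -> F) (u : V + Z) : F := match u with
  | inl v => if insub v is Some v' then w (inl v') else 0
  | inr a => w (inr a)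
  end.
have pext u : polyfun (fun w => ext w u).
  case: u => [v|a] /=; last exact: polyfun_var.
  by case: insub => [v'|]; [exact: polyfun_var | exact: polyfun_cst].
pose p' v (w : W -> F) : F := match insub v with
  | Some v' => w (inl v') * delta (ext w)
  | None => p v (ext w)
  end.
apply: (@thin_image _ V W X (fun w => delta (ext w)) p').
- have cE : #|{: {v | v \notin E}}| = #|~: E|.
    by rewrite card_sig; apply: eq_card => v; rewrite !inE.
  rewrite card_sum cE.
  by have := cardsC E; lia.
- exact: polyfun_comp.
- move=> v; rewrite /p'; case: insub => [v'|]; last exact: polyfun_comp.
  by apply: polyfun_mul; [exact: polyfun_var | exact: polyfun_comp].
move=> x /HX[z]; set y := (fun u => _) => -[dy ey].
exists (fun w => match w with inl v' => x (val v') | inr a => z a end).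
all: set w := (fun w => _).
all: have wy : ext w = y
  by apply/funext => -[v|a] //=; case: insubP => [v' vE vv'|];
    [rewrite (negbTE vE) -vv' | rewrite negbK => ->].
  by rewrite wy.
move=> v; rewrite /p' wy; case: insubP => [v' _ <- //|].
by rewrite negbK; exact: ey.
Qed.

Section LowRank.
Variables (I J K r : nat).

Let V : finType := ('I_I * 'I_r + 'I_J * 'I_r + 'I_K * 'I_r)%type.

Definition matA (x : V -> F) : 'M[F]_(I, r) :=
  \matrix_(i, q) x (inl (inl (i, q))).
Definition matB (x : V -> F) : 'M[F]_(J, r) :=
  \matrix_(j, q) x (inl (inr (j, q))).
Definition matC (x : V -> F) : 'M[F]_(K, r) := \matrix_(k, q) x (inr (k, q)).

(** One chart of the degenerate set: the columns indexed by [Q] span the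
    contraction, the [I] columns indexed by [T] lie in the support of
    [f *m C], and [f] is normalized at [k0]. *)
Section Chart.
Variables (rho : nat) (Q : {ffun 'I_rho -> 'I_J}) (T : {ffun 'I_I -> 'I_r}).
Variable k0 : 'I_K.
Hypotheses (injQ : injective Q) (injT : injective T).

(* the auxiliary parameters: the coefficients of the other columns of the
   contraction on those in [Q], and the entries of [f] other than [k0] *)
Let Z : finType :=
  ('I_rho * {j | j \notin codom Q} + {k | k != k0})%type.

(* the entries of [B] to be solved for *)
Let E : {set V} := [set v | match v with
  | inl (inr (j, q)) => (j \notin codom Q) && (q \in codom T)
  | _ => false
  end].

Let card_coQ : #|[pred j | j \notin codom Q]| = (J - rho)%N.
Proof.
have := cardC (mem (codom Q)); rewrite card_codom// !card_ord => cQ.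
have -> : #|[pred j | j \notin codom Q]| = #|predC (mem (codom Q))|.
  by apply: eq_card => j; rewrite !inE.
move: cQ; set c := #|predC _| => cQ; apply/esym/eqP.
by rewrite -(eqn_add2l rho) subnKC ?cQ// -cQ leq_addr.
Qed.

Let card_E : (#|E| = (J - rho) * I)%N.
Proof.
rewrite (_ : E = [set inl (inr u) | u in
    finset.setX [set j | j \notin codom Q] [set q | q \in codom T]]).
  rewrite card_imset => [|[j q] [j' q'] [-> ->]//].
  rewrite cardsX; congr (_ * _)%N; last first.
    by rewrite cardsE card_codom// card_ord.
  by rewrite cardsE card_coQ.
apply/setP => v; apply/idP/imsetP => [|[[j q] + ->]]; last by rewrite !inE.
case: v => [[a|[j q]]|a]; rewrite ?inE// => jq.
by exists (j, q) => //; rewrite !inE.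
Qed.

Let card_Z : (#|Z| = rho * (J - rho) + K.-1)%N.
Proof.
rewrite card_sum card_prod !card_sig card_ord; congr (_ * _ + _)%N.
  exact: card_coQ.
by rewrite (eq_card (B := predC1 k0)) ?cardC1 ?card_ord.
Qed.

Let yA (y : V + Z -> F) := matA (fun v => y (inl v)).
Let yB (y : V + Z -> F) := matB (fun v => y (inl v)).
Let yC (y : V + Z -> F) := matC (fun v => y (inl v)).
Let yf (y : V + Z -> F) : 'rV[F]_K :=
  \row_k if insub k is Some k' then y (inr (inr k')) else 1.
Let yN (y : V + Z -> F) : 'M[F]_(rho, J) :=
  \matrix_(l, j) if insub j is Some j' then y (inr (inl (l, j'))) else 0.

(* With the eliminated entries of [B] masked, [yM] agrees with the contraction
   on the columns in [Q], and on the other columns it misses exactly the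
   contribution of the columns of [A] in [T], that is [yG] times the masked
   entries; [yH] computes this contribution. *)
Let yD y := diag_mx (yf y *m yC y).
Let yM y := yA y *m yD y *m (yB y)^T.
Let yG y := colsub T (yA y *m yD y).
Let yH y := colsub Q (yM y) *m yN y - yM y.

Let p (v : V) (y : V + Z -> F) : F := match v with
  | inl (inr (j, q)) =>
      if [pick t | T t == q] is Some t then (\adj (yG y) *m yH y) t j else 0
  | _ => 0
  end.

Let polymx_sub m n (M N : (V + Z -> F) -> 'M[F]_(m, n)) :
  polymx M -> polymx N -> polymx (fun y => M y - N y).
Proof.
move=> pM pN i j; apply: (@eq_polyfun _ _ (fun y => M y i j + - N y i j)).
  by move=> y; rewrite !mxE.
by apply: polyfun_add => //; exact: polyfun_opp.
Qed.

Let polymx_colsub m n n' (s : 'I_n' -> 'I_n)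
    (M : (V + Z -> F) -> 'M[F]_(m, n)) :
  polymx M -> polymx (fun y => colsub s (M y)).
Proof. by move=> pM i j; apply: eq_polyfun (pM i (s j)) => y; rewrite mxE. Qed.

Let polymx_yD : polymx yD.
Proof.
have pf : polymx yf.
  move=> i k; apply: (@eq_polyfun _ _ (fun y =>
      if insub k is Some k' then y (inr (inr k')) else 1)) => [y|].
    by rewrite mxE.
  by case: insub => [k'|]; [exact: polyfun_var | exact: polyfun_cst].
have pC : polymx yC.
  move=> k q.
  by apply: eq_polyfun (polyfun_var _ (inl (inr (k, q)))) => y; rewrite mxE.
move=> q q'; case: (eqVneq q q') => [<-|qq'].
  by apply: eq_polyfun (polymx_mul pf pC 0 q) => y; rewrite [RHS]mxE eqxx.
apply: eq_polyfun (polyfun_cst _ 0) => y.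
by rewrite mxE (negbTE qq').
Qed.

Let polymx_yA : polymx yA.
Proof.
move=> i q; apply: eq_polyfun (polyfun_var _ (inl (inl (inl (i, q))))) => y.
by rewrite mxE.
Qed.

Let polymx_yG : polymx yG.
Proof. exact/polymx_colsub/polymx_mul. Qed.

Let polymx_yH : polymx yH.
Proof.
have pM : polymx yM.
  apply: polymx_mul; first exact: polymx_mul.
  move=> q j; apply: eq_polyfun (polyfun_var _ (inl (inl (inr (j, q))))) => y.
  by rewrite !mxE.
apply: polymx_sub => //; apply: polymx_mul; first exact: polymx_colsub.
move=> l j; apply: (@eq_polyfun _ _ (fun y =>
    if insub j is Some j' then y (inr (inl (l, j'))) else 0)) => [y|].
  by rewrite mxE.
by case: insub => [j'|]; [exact: polyfun_var | exact: polyfun_cst].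
Qed.

(** The linear systems with matrix [yG], one for each [j] outside [Q], are
    solved by Cramer's rule.  They eliminate [I * (J - rho)] coordinates at the
    cost of [rho * (J - rho) + K - 1] parameters. *)
Lemma thin_low_rank_chart : (K.-1 < (I - rho) * (J - rho))%N ->
  thin (fun x : V -> F => general_position (matA x) /\
    exists f : 'rV_K, [/\ f 0 k0 = 1,
      forall t, (f *m matC x) 0 (T t) != 0 &
      exists N, wsum (matA x) (matB x) (f *m matC x) =
        colsub Q (wsum (matA x) (matB x) (f *m matC x)) *m N]).
Proof.
move=> dim; apply: (@thin_elimination V Z E _ (fun y => \det (yG y)) p).
- by rewrite card_E card_Z; nia.
- exact: polyfun_det.
- case=> [[|[j q]]|]; [by move=> ?; exact: polyfun_cst| |
    by move=> ?; exact: polyfun_cst].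
  by rewrite /p; case: pickP => [t _|_]; [exact: polymx_mul (polymx_adj _) _ _ _
    | exact: polyfun_cst].
move=> x [gpA [f [fk fT [N MN]]]].
exists (fun a => match a with
  | inl (l, j) => N l (val j) | inr k => f 0 (val k) end).
set y := (fun u => _) => /=.
have yAE : yA y = matA x by apply/matrixP => i q; rewrite !mxE /y inE.
have yCE : yC y = matC x by apply/matrixP => i q; rewrite !mxE /y inE.
have yfE : yf y = f.
  apply/rowP => k; rewrite mxE; case: insubP => [k' _ <- //|].
  by rewrite negbK => /eqP->.
have yBE j q : yB y j q =
    if (j \notin codom Q) && (q \in codom T) then 0 else matB x j q.
  by rewrite !mxE /y inE.
have yNE l j : j \notin codom Q -> yN y l j = N l j.
  by move=> jQ; rewrite mxE; case: insubP => [j' _ <- //|]; rewrite jQ.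
set d := f *m matC x in fT MN.
have yGE : yG y = colsub T (matA x) *m diag_mx (colsub T d).
  rewrite /yG /yD yAE yCE yfE; apply/matrixP => i t.
  by rewrite mul_mx_diag [LHS]mxE mul_mx_diag !mxE.
have yME : yM y = wsum (matA x) (yB y) d by rewrite /yM /yD yAE yCE yfE.
split.
  rewrite yGE det_mulmx det_diag mulf_neq0 ?general_position_unit//.
  by apply/prodf_neq0 => t _; rewrite mxE.
move=> [[a|[j q]]|a]; rewrite inE// => /andP[jQ qT].
have /codomP[t qt] := qT; rewrite /p; case: pickP => [t'|/(_ t)]; last first.
  by rewrite -qt eqxx.
move=> /eqP; rewrite qt => /injT -> {t'}.
pose Bt : 'M[F]_(I, J) := \matrix_(t, j) matB x j (T t).
have GB i : (yG y *m Bt) i j = yH y i j.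
  have MQ l : yM y i (Q l) = wsum (matA x) (matB x) d i (Q l).
    rewrite yME !wsumE; apply: eq_bigr => q' _.
    by rewrite yBE codom_f.
  have -> : yH y i j = wsum (matA x) (matB x) d i j - yM y i j.
    rewrite [LHS]mxE [X in _ + X]mxE; congr (_ - _).
    rewrite MN [LHS]mxE [RHS]mxE; apply: eq_bigr => l _.
    by rewrite yNE// [X in X * _]mxE MQ [X in _ = X * _]mxE.
  rewrite yME !wsumE -sumrB yGE mxE.
  rewrite [RHS](bigID (mem (codom T)))/= [X in _ + X]big1 ?addr0; last first.
    by move=> q' q'T; rewrite yBE (negbTE q'T) andbF subrr.
  rewrite -big_uniq/=; last by rewrite map_inj_uniq ?enum_uniq.
  rewrite big_image/=; apply: eq_bigr => t' _.
  by rewrite mul_mx_diag yBE jQ codom_f mulr0 subr0 !mxE.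
have -> : (\adj (yG y) *m yH y) t j = (\adj (yG y) *m (yG y *m Bt)) t j.
  by rewrite mxE [RHS]mxE; apply: eq_bigr => i _; rewrite GB.
by rewrite mulmxA mul_adj_mx mul_scalar_mx !mxE mulrC.
Qed.

End Chart.

(** If the support of [f *m C] has at most [I] elements, then the rank of the
    contraction equals its size by rank_wsum; otherwise [I] of its elements can
    be used for a chart.  The rank in the chart may be smaller than the bound
    [r - K + 1], which only helps the dimension count. *)
Lemma thin_low_rank : (0 < K)%N -> (I <= r)%N -> (J <= r)%N -> (I <= J)%N ->
  (r - K < I)%N -> (K <= (I - (r - K).+1) * (J - (r - K).+1))%N ->
  thin (fun x : V -> F => [/\ general_position (matA x),
    general_position (matB x) &
    ~ low_rank_trivial (matA x) (matB x) (matC x)]).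
Proof.
move=> K0 Ir Jr IJ rI dim.
apply: (@thin_sub _ _ _ (fun x => exists (rho : 'I_(r - K).+2)
    (Q : {ffun 'I_rho -> 'I_J}) (T : {ffun 'I_I -> 'I_r}) (k0 : 'I_K),
    injective Q /\ injective T /\ general_position (matA x) /\
    exists f : 'rV_K, [/\ f 0 k0 = 1,
      forall t, (f *m matC x) 0 (T t) != 0 &
      exists N, wsum (matA x) (matB x) (f *m matC x) =
        colsub Q (wsum (matA x) (matB x) (f *m matC x)) *m N])).
  move=> x [gpA gpB nlrt]; apply: contrapT => H; apply: nlrt => f f0 rk.
  rewrite leqNgt; apply/negP => sf.
  have [sI|/ltnW sI] := leqP #|supp (f *m matC x)| I.
    by move: rk; rewrite rank_wsum//; lia.
  apply: H; have [T injT sT] := exists_injection sI.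
  have [Q injQ [N MN]] :=
    rank_column_basis (wsum (matA x) (matB x) (f *m matC x)).
  have /rV0Pn[k0 fk0] := f0.
  have rk' : (\rank (wsum (matA x) (matB x) (f *m matC x)) < (r - K).+2)%N.
    by [].
  exists (Ordinal rk'), Q, T, k0; do 3!split=> //.
  exists ((f 0 k0)^-1 *: f).
  have dE : (f 0 k0)^-1 *: f *m matC x = (f 0 k0)^-1 *: (f *m matC x).
    by rewrite scalemxAl.
  have wE : wsum (matA x) (matB x) ((f 0 k0)^-1 *: (f *m matC x)) =
      (f 0 k0)^-1 *: wsum (matA x) (matB x) (f *m matC x).
    apply/matrixP => i j; rewrite [RHS]mxE !wsumE mulr_sumr.
    by apply: eq_bigr => q _; rewrite [X in _ * X * _]mxE mulrCA !mulrA.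
  split; first by rewrite mxE mulVf.
    move=> t; rewrite dE mxE mulf_neq0 ?invr_eq0//.
    by have := sT t; rewrite inE.
  exists N; rewrite dE wE {1}MN scalemxAl; congr (_ *m _).
  by apply/matrixP => i j; rewrite !mxE.
apply: thin_bigU => rho; apply: thin_bigU => Q; apply: thin_bigU => T.
apply: thin_bigU => k0.
have [injQ|] := pselect (injective Q); last first.
  by move=> nQ; apply: thin_sub (thin0 F V) => x [].
have [injT|] := pselect (injective T); last first.
  by move=> nT; apply: thin_sub (thin0 F V) => x [_ []].
apply: thin_sub (@thin_low_rank_chart _ Q T k0 injQ injT _) => [x [_ []]//|].
have := ltn_ord rho; rewrite ltnS => rhoE.
apply: (@leq_trans K); first by lia.
by apply: leq_trans dim _; apply: leq_mul; lia.
Qed.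

Theorem thin_degenerate : (0 < K <= r)%N -> (I <= r)%N -> (J <= r)%N ->
  (I <= J)%N ->
  (r - K < I)%N -> (K <= (I - (r - K).+1) * (J - (r - K).+1))%N ->
  thin (fun x : V -> F => ~ [/\ general_position (matA x),
    general_position (matB x), general_position (matC x) &
    low_rank_trivial (matA x) (matB x) (matC x)]).
Proof.
move=> /andP[K0 Kr] Ir Jr IJ rI dim.
have tA : thin (fun x : V -> F => ~ general_position (matA x)).
  apply: thin_not_general_position => [i q|X].
    by apply: eq_polyfun (polyfun_var _ (inl (inl (i, q)))) => x; rewrite mxE.
  exists (fun v => if v is inl (inl u) then X u.1 u.2 else 0).
  by apply/matrixP => i q; rewrite mxE.
have tB : thin (fun x : V -> F => ~ general_position (matB x)).
  apply: thin_not_general_position => [i q|X].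
    by apply: eq_polyfun (polyfun_var _ (inl (inr (i, q)))) => x; rewrite mxE.
  exists (fun v => if v is inl (inr u) then X u.1 u.2 else 0).
  by apply/matrixP => i q; rewrite mxE.
have tC : thin (fun x : V -> F => ~ general_position (matC x)).
  apply: thin_not_general_position => [i q|X].
    by apply: eq_polyfun (polyfun_var _ (inr (i, q))) => x; rewrite mxE.
  exists (fun v => if v is inr u then X u.1 u.2 else 0).
  by apply/matrixP => i q; rewrite mxE.
have tL := thin_low_rank K0 Ir Jr IJ rI dim.
apply: thin_sub (thinU (thinU tA tB) (thinU tC tL)) => x nx.
have [gA|] := pselect (general_position (matA x)); last by left; left.
have [gB|] := pselect (general_position (matB x)); last by left; right.
have [gC|] := pselect (general_position (matC x)); last by right; left.
by right; right; split=> // lrt; apply: nx.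
Qed.

End LowRank.
End Genericity.

(** * Uniqueness of the canonical polyadic decomposition *)
Section Uniqueness.
Variable F : fieldType.

Lemma col_neq0 n r (X : 'M[F]_(n, r)) q : (0 < n <= r)%N ->
  general_position X -> col q X != 0.
Proof.
move=> /andP[n0 nr] gpX.
have [||u _] := @exists_dual _ _ _ _ nr gpX finset.set0 q;
  rewrite ?cards0 ?inE//.
apply: contra_eq_neq => Xq.
have -> : (u *m X) 0 q = (u *m col q X) 0 0.
  by rewrite !mxE; apply: eq_bigr => i _; rewrite !mxE.
by rewrite Xq mulmx0 mxE eq_sym oner_eq0.
Qed.

Lemma rank1_neq0 I J K (t : tensor F I J K) : rank1 t -> t != 0.
Proof.
move=> [a [b [c [/cV0Pn[i ai] /cV0Pn[j bj] /cV0Pn[k ck] ->]]]].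
apply/negP => /eqP/ffunP/(_ (i, j, k)); rewrite !ffunE/= => /eqP.
by rewrite !mulf_eq0 (negbTE ai) (negbTE bj) (negbTE ck).
Qed.

(** Any decomposition with at most [r] terms, written with factor matrices and
    padded with zero terms, has the given terms up to order.  As those are
    nonzero, no padding occurred: the rank is [r] and all minimal decompositions
    are permutations of the given one. *)
Lemma cpd_unique_of_general I J K r (A : 'M[F]_(I, r)) (B : 'M[F]_(J, r))
    (C : 'M[F]_(K, r)) :
  (1 < K <= r)%N -> (r - K < I.-1)%N -> (r - K < J.-1)%N ->
  (I <= r)%N -> (J <= r)%N ->
  general_position A -> general_position B -> general_position C ->
  low_rank_trivial A B C ->
  cpd_unique (cpd_tensor A B C).
Proof.
move=> K1r rI rJ Ir Jr gpA gpB gpC lrt; have /andP[K1 Kr] := K1r.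
set T := cpd_tensor A B C.
pose D q := outer (col q A) (col q B) (col q C).
pose terms := [seq D q | q <- enum 'I_r].
have rank1D q : rank1 (D q).
  exists (col q A), (col q B), (col q C).
  by split=> //; apply: col_neq0 => //; lia.
have rkT : (tensor_rank T <= r)%N.
  rewrite /tensor_rank; case: ex_minnP => m _; apply.
  apply/asboolP; exists terms; last by rewrite size_map size_enum_ord.
  split; first by move=> _ /mapP[q _ ->].
  by rewrite big_map big_enum.
suff key s : polyadic_decomp T s -> (size s <= r)%N -> perm_eq s terms.
  move=> s s' [ds ss] [ds' ss'].
  rewrite (perm_trans (key _ ds _)) ?ss// perm_sym; apply: key => //.
  by rewrite ss'.
move=> [r1s Ts] sr.
have /choice[abc abcE] : forall t, exists abc : 'cV[F]_I * 'cV[F]_J * 'cV[F]_K,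
    t \in s -> t = outer abc.1.1 abc.1.2 abc.2.
  move=> t; have [ts|] := boolP (t \in s); last first.
    by exists (0, 0, 0).
  by have [a [b [c [_ _ _ ->]]]] := r1s t ts; exists (a, b, c).
(* padding is done in the first factor; beyond [size s] the other two contain
   the vectors chosen for the default value of [nth] *)
pose A' : 'M[F]_(I, r) :=
  \matrix_(i, q) if (q < size s)%N then (abc s`_q).1.1 i 0 else 0.
pose B' : 'M[F]_(J, r) := \matrix_(j, q) (abc s`_q).1.2 j 0.
pose C' : 'M[F]_(K, r) := \matrix_(k, q) (abc s`_q).2 k 0.
have s_nth q i j k : A' i q * B' j q * C' k q = s`_q (i, j, k).
  rewrite !mxE; case: ltnP => qs; last by rewrite nth_default// !mul0r ffunE.
  by rewrite [in RHS](abcE _ (mem_nth _ qs)) ffunE.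
have wsumT (X : 'M[F]_(I, r)) (Y : 'M[F]_(J, r)) (Z : 'M[F]_(K, r)) f i j :
    wsum X Y (f *m Z) i j =
    \sum_k f 0 k * \sum_q X i q * Y j q * Z k q.
  rewrite wsumE; under [RHS]eq_bigr do rewrite mulr_sumr.
  rewrite exchange_big; apply: eq_bigr => q _; rewrite mxE mulr_sumr mulr_suml.
  by apply: eq_bigr => k _; ring.
have TE i j k : \sum_q A i q * B j q * C k q = \sum_q A' i q * B' j q * C' k q.
  transitivity (T (i, j, k)).
    by rewrite sum_ffunE; apply: eq_bigr => q _; rewrite ffunE !mxE.
  rewrite Ts sum_ffunE (big_nth 0) big_mkord.
  rewrite (big_ord_widen _ (fun q => s`_q (i, j, k)) sr).
  rewrite [RHS](bigID (fun q : 'I_r => (q < size s)%N))/=.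
  rewrite [X in _ + X]big1 ?addr0.
    by apply: eq_bigr => q _; rewrite s_nth.
  by move=> q; rewrite -leqNgt => qs; rewrite s_nth nth_default// ffunE.
have [|p pE] := terms_unique K1r rI rJ Ir Jr gpA gpB gpC lrt
  (A' := A') (B' := B') (C' := C').
  move=> f; apply/matrixP => i j; rewrite !wsumT.
  by apply: eq_bigr => k _; rewrite TE.
have sD (q : 'I_r) : s`_q = D (p q).
  by apply/ffunP => -[[i j] k]; rewrite -s_nth pE ffunE !mxE.
have ssr : size s = r.
  apply/eqP; rewrite eqn_leq sr leqNgt; apply/negP => sr'.
  have := sD (Ordinal sr'); rewrite nth_default// => D0.
  by have := rank1_neq0 (rank1D (p (Ordinal sr'))); rewrite -D0 eqxx.
have -> : s = [seq D q | q <- [seq p q | q <- enum 'I_r]].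
  apply: (@eq_from_nth _ 0); first by rewrite !size_map -enumT size_enum_ord.
  move=> q; rewrite ssr => qr; rewrite -map_comp (nth_map (Ordinal qr));
    rewrite -?enumT ?size_enum_ord//.
  rewrite -[q in LHS]/(val (Ordinal qr)) sD; congr (D (p _)).
  by apply: val_inj; rewrite /= nth_enum_ord.
apply/perm_map/uniq_perm; rewrite ?enum_uniq ?map_inj_uniq ?enum_uniq//.
- by rewrite -enumT enum_uniq.
- exact: perm_inj.
move=> q; rewrite mem_enum; apply/mapP.
exists ((p^-1)%g q); rewrite ?mem_enum//.
by rewrite permKV.
Qed.

End Uniqueness.

(** * Thin sets are Lebesgue-null *)
Local Open Scope classical_set_scope.
Local Open Scope ring_scope.

Section NullPolynomials.
Variable R : realType.

(** The coordinates [x] are kept abstract so that products, tuples, matrices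
    and images of measures can be treated uniformly, with real coordinates even
    for complex parameters. *)
Definition polynull d (T : measurableType d) (mu : set T -> \bar R)
    (V : Type) (x : T -> V -> R) :=
  (forall v, measurable_fun setT (x ^~ v)) /\
  forall f, polyfun f -> (exists y, f y != 0) ->
    mu [set t | f (x t) = 0] = 0%E.

Lemma measurable_polyfun d (T : measurableType d) V (x : T -> V -> R) f :
  (forall v, measurable_fun setT (x ^~ v)) -> polyfun f ->
  measurable_fun setT (fun t => f (x t)).
Proof.
move=> mx; elim=> [c|v|g h _ IHg _ IHh|g h _ IHg _ IHh].
- exact: measurable_cst.
- exact: mx.
- exact: measurable_funD.
- exact: measurable_funM.
Qed.

Lemma measurable_zero_set d (T : measurableType d) V (x : T -> V -> R) f :
  (forall v, measurable_fun setT (x ^~ v)) -> polyfun f ->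
  measurable [set t | f (x t) = 0].
Proof.
move=> mx pf.
have /(_ measurableT [set 0] (measurable_set1 _)) := measurable_polyfun mx pf.
by rewrite setTI.
Qed.

Lemma polynull_lebesgue :
  polynull (@lebesgue_measure R) (fun t (_ : unit) => t).
Proof.
split=> [v|f pf [y fy]]; first exact: measurable_id.
apply: countable_lebesgue_measure0; apply: finite_set_countable.
have [E /(_ (fun=> 0) (fun=> 1))[q _ qE]] := polyfun_deg pf.
have fE t : f (fun=> t) = q.[t].
  by rewrite -qE; congr f; apply/funext => v; rewrite add0r mulr1.
have q0 : q != 0.
  apply: contraNneq fy => q0; rewrite (_ : y = fun=> y tt); last first.
    by apply/funext => -[].
  by rewrite fE q0 horner0.
apply: contrapT => /(infinite_set_fset (size q))[B Bf Bq].
move/eqP: q0; apply; apply: (roots_geq_poly_eq0 _ (finmap.fset_uniq B) Bq).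
by apply/allP => t /Bf /=; rewrite fE => /eqP.
Qed.

(** Fix the last variables at a point where [f] does not vanish: for almost
    every value of the first ones the remaining polynomial is nonzero, so the
    section of the zero set is null. *)
Lemma polynull_product d1 d2 (T1 : measurableType d1) (T2 : measurableType d2)
    (mu1 : {measure set T1 -> \bar R})
    (mu2 : {sigma_finite_measure set T2 -> \bar R})
    V1 V2 (x1 : T1 -> V1 -> R) (x2 : T2 -> V2 -> R) :
  polynull mu1 x1 -> polynull mu2 x2 ->
  polynull (mu1 \x mu2)%E
    (fun t v => match v with inl v => x1 t.1 v | inr v => x2 t.2 v end).
Proof.
move=> [mx1 null1] [mx2 null2].
have mx v : measurable_fun setT (fun t : T1 * T2 =>
    match v with inl v => x1 t.1 v | inr v => x2 t.2 v end).
  case: v => v; first exact: (measurableT_comp (mx1 v) measurable_fst).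
  exact: (measurableT_comp (mx2 v) measurable_snd).
split=> // f pf [y fy].
pose glue (a : V1 -> R) (b : V2 -> R) (v : V1 + V2) : R :=
  match v with inl v => a v | inr v => b v end.
have pl b : polyfun (fun a => f (glue a b)).
  apply: polyfun_comp => // -[v|v]; [exact: polyfun_var | exact: polyfun_cst].
have pr a : polyfun (fun b => f (glue a b)).
  apply: polyfun_comp => // -[v|v]; [exact: polyfun_cst | exact: polyfun_var].
pose y1 v := y (inl v); pose y2 v := y (inr v).
have yE : glue y1 y2 = y by apply/funext => -[].
set A := [set t | _].
have mA : measurable A by exact: (measurable_zero_set mx pf).
pose N := [set t1 | f (glue (x1 t1) y2) = 0].
rewrite /product_measure1.
rewrite (@ge0_ae_eq_integral _ _ _ mu1 setT _ (cst 0%E))//.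
  exact: integral0.
  exact: measurable_fun_xsection.
exists N; split.
- exact: (measurable_zero_set mx1 (pl y2)).
- by apply: (null1 _ (pl y2)); exists y1; rewrite yE.
move=> t1 /= H; apply: contrapT => /eqP Nt1; apply: H => _ /=.
rewrite -[RHS](null2 _ (pr (x1 t1))); last by exists y2.
congr (mu2 _); apply/seteqP; split=> t2; rewrite /xsection/= inE /A/=.
  by [].
by [].
Qed.

(** Through [h] the new coordinates become some of the old ones, and an
    injective renaming of variables keeps polynomials nonzero. *)
Lemma polynull_image d1 d2 (T1 : measurableType d1) (T2 : measurableType d2)
    (mu : set T1 -> \bar R) (h : T1 -> T2) V W (x1 : T1 -> V -> R)
    (x2 : T2 -> W -> R) (s : W -> V) :
  injective s ->
  (forall w, measurable_fun setT (x2 ^~ w)) ->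
  (forall t w, x2 (h t) w = x1 t (s w)) ->
  polynull mu x1 -> polynull (pushforward mu h) x2.
Proof.
move=> injs mx2 x12 [mx1 null1]; split=> // f pf [y fy].
rewrite /pushforward -[RHS](null1 (fun a => f (fun w => a (s w)))).
- congr mu; apply/seteqP; split=> t /=;
    by rewrite (_ : x2 (h t) = fun w => x1 t (s w))//; apply/funext.
- by apply: polyfun_comp => // w; exact: polyfun_var.
- have [sinv sK] : exists sinv : V -> option W, forall w, sinv (s w) = Some w.
    have /choice[g gE] : forall v, exists w, forall w', s w' = v -> w = Some w'.
      move=> v; have [[w <-]|nw] := pselect (exists w, s w = v).
        by exists (Some w) => w' /injs->.
      by exists None => w' sw; case: nw; exists w'.
    by exists g => w; exact: gE.
  exists (fun v => if sinv v is Some w then y w else 0).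
  by rewrite (_ : (fun w => _) = y)//; apply/funext => w; rewrite sK.
Qed.

Lemma polynull_tuple d (T : measurableType d)
    (mu : {sigma_finite_measure set T -> \bar R}) V (x : T -> V -> R) n :
  polynull mu x ->
  polynull (tuple_power mu n) (fun t (iv : 'I_n * V) => x (tnth t iv.1) iv.2).
Proof.
move=> nx; have [mx _] := nx.
have mtx m (iv : 'I_m * V) :
    measurable_fun setT (fun t : m.-tuple T => x (tnth t iv.1) iv.2).
  exact: (measurableT_comp (mx iv.2) (measurable_tnth iv.1)).
elim: n => [|n IH].
  split=> [|f pf [y fy] /=]; first exact: mtx.
  rewrite diracE memNset//= => ft.
  move/eqP: fy; apply; rewrite -ft; congr f; apply/funext => -[i v].
  by have := ltn_ord i.
(* a tuple of length [n + 1] is the image of its head and its tail *)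
pose s (iv : 'I_n.+1 * V) : V + 'I_n * V :=
  if unlift ord0 iv.1 is Some i then inr (i, iv.2) else inl iv.2.
apply: (@polynull_image _ _ _ _ _ _ _ _ _ _ s _ _ _ (polynull_product nx IH)).
- move=> [i v] [i' v']; rewrite /s /=.
  case: (unliftP ord0 i) => [j|] ->;
    by case: (unliftP ord0 i') => [j'|] -> //= [] -> // ->.
- exact: mtx.
- move=> [t1 t2] [i v]; rewrite /s /=; case: (unliftP ord0 i) => [j|] -> //=.
  by rewrite tnthS.
Qed.

Lemma polynull_matrix d (T : measurableType d)
    (mu : {sigma_finite_measure set T -> \bar R}) V (x : T -> V -> R) m n :
  polynull mu x ->
  polynull (mx_power mu m n)
    (fun (M : 'M[T]_(m, n)) (iv : 'I_m * 'I_n * V) => x (M iv.1.1 iv.1.2) iv.2).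
Proof.
move=> nx; have [mx _] := nx.
apply: (@polynull_image _ _ _ _ _ _ _ _ _ _
  (fun iv => (mxvec_index iv.1.1 iv.1.2, iv.2))
  _ _ _ (polynull_tuple (m * n) nx)).
- pose p k : 'I_m * 'I_n := enum_val (cast_ord (esym (mxvec_cast m n)) k).
  have pE i j : p (mxvec_index i j) = (i, j) by rewrite /p cast_ordK enum_rankK.
  move=> [[i j] v] [[i' j'] v'] e; have := congr1 (fun kv => p kv.1) e.
  by have := congr1 snd e; rewrite /= !pE => -> -[-> ->].
- move=> [[i j] v] /=.
  have mM : measurable_fun setT (fun M : 'M[T]_(m, n) => M i j).
    move=> _ U mU; rewrite setTI; apply: sub_sigma_algebra.
    by exists (i, j) => //; exists U.
  exact: (measurableT_comp (mx v) mM).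
- by move=> t [[i j] v] /=; rewrite mxE.
Qed.

Lemma negligible_zero_set d (T : measurableType d)
    (mu : {measure set T -> \bar R}) V (x : T -> V -> R) f (X : set T) :
  polynull mu x -> polyfun f -> (exists y, f y != 0) ->
  (forall t, X t -> f (x t) = 0) -> mu.-negligible X.
Proof.
move=> [mx null] pf nf Xf; exists [set t | f (x t) = 0]; split=> //.
- exact: measurable_zero_set mx pf.
- exact: null.
Qed.

Definition complex_coord (z : R[i]) (b : unit + unit) : R :=
  if b is inl _ then complex.Re z else complex.Im z.

Lemma polynull_complex :
  polynull (@complex_lebesgue_measure R) complex_coord.
Proof.
have mRe : measurable_fun setT (fun z : R[i] => complex.Re z).
  exact: (measurableT_comp measurable_fst (@measurable_complex_pair R)).
have mIm : measurable_fun setT (fun z : R[i] => complex.Im z).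
  exact: (measurableT_comp measurable_snd (@measurable_complex_pair R)).
apply: (polynull_image (s := id) _ _ _
  (polynull_product polynull_lebesgue polynull_lebesgue)) => [b b' //| |].
  by case.
by move=> [a b] [].
Qed.

(** The variables [inl] and [inr] of the sum type stand for the real and the
    imaginary parts. *)
Lemma polyfun_complex V (f : (V -> R[i]) -> R[i]) : polyfun f ->
  exists u v : (V * (unit + unit) -> R) -> R, [/\ polyfun u, polyfun v &
    forall z, let y vb := complex_coord (z vb.1) vb.2 in f z = (u y +i* v y)%C].
Proof.
elim=> [[a b]|v|g h _ [u [v [pu pv gE]]] _ [u' [v' [pu' pv' hE]]]
  |g h _ [u [v [pu pv gE]]] _ [u' [v' [pu' pv' hE]]]].
- exists (fun=> a), (fun=> b); split=> //; exact: polyfun_cst.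
- exists (fun y => y (v, inl tt)), (fun y => y (v, inr tt)); split.
  + exact: polyfun_var.
  + exact: polyfun_var.
  + by move=> z; rewrite /complex_coord /=; case: (z v).
- exists (fun y => u y + u' y), (fun y => v y + v' y); split.
  + exact: polyfun_add.
  + exact: polyfun_add.
  + by move=> z; rewrite gE hE.
- exists (fun y => u y * u' y + - (v y * v' y)),
    (fun y => u y * v' y + v y * u' y); split.
  + by apply: polyfun_add; [|apply: polyfun_opp]; exact: polyfun_mul.
  + by apply: polyfun_add; exact: polyfun_mul.
  + by move=> z; rewrite gE hE.
Qed.

Section ParameterSpace.
Variables (I J K r : nat).

Definition params (T : Type) (ABC : 'M[T]_(I, r) * 'M[T]_(J, r) * 'M[T]_(K, r))
    (v : 'I_I * 'I_r + 'I_J * 'I_r + 'I_K * 'I_r) : T :=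
  match v with
  | inl (inl iq) => ABC.1.1 iq.1 iq.2
  | inl (inr jq) => ABC.1.2 jq.1 jq.2
  | inr kq => ABC.2 kq.1 kq.2
  end.

Lemma polynull_factor_matrices d (T : measurableType d)
    (mu : {sigma_finite_measure set T -> \bar R}) V (x : T -> V -> R) :
  polynull mu x ->
  polynull (factor_matrices_measure mu I J K r)
    (fun ABC vw => x (params ABC vw.1) vw.2).
Proof.
move=> nx; have [mx _] := nx.
have nA := polynull_matrix I r nx; have nB := polynull_matrix J r nx.
have nC := polynull_matrix K r nx.
have nABC := polynull_product (polynull_product nA nB) nC.
pose s (vw : ('I_I * 'I_r + 'I_J * 'I_r + 'I_K * 'I_r) * V) :=
  match vw.1 with
  | inl (inl iq) => inl (inl (iq, vw.2))
  | inl (inr jq) => inl (inr (jq, vw.2))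
  | inr kq => inr (kq, vw.2)
  end : 'I_I * 'I_r * V + 'I_J * 'I_r * V + 'I_K * 'I_r * V.
have xs (ABC : 'M[T]_(I, r) * 'M[T]_(J, r) * 'M[T]_(K, r)) vw :
    x (params ABC vw.1) vw.2 = match s vw with
      | inl (inl v) => x (ABC.1.1 v.1.1 v.1.2) v.2
      | inl (inr v) => x (ABC.1.2 v.1.1 v.1.2) v.2
      | inr v => x (ABC.2 v.1.1 v.1.2) v.2
      end.
  by case: vw => [[[?|?]|?] ?].
apply: (polynull_image (h := id) (s := s) _ _ xs nABC).
- by move=> [[[?|?]|?] ?] [[[?|?]|?] ?] //= [-> ->].
- move=> vw; under eq_fun do rewrite xs.
  exact: (nABC.1 (s vw)).
Qed.

End ParameterSpace.

End NullPolynomials.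

(** * The two forms of the bound *)
(** With [rho = r - K + 1], the last condition compares [K] with the
    codimension of the [I x J] matrices of rank at most [rho]. *)
Definition codim_bound (I J K r : nat) : Prop :=
  [/\ (I <= J)%N, (J <= K)%N, (K <= r)%N, ((r - K).+1 < I)%N &
    (K <= (I - (r - K).+1) * (J - (r - K).+1))%N].

Lemma int_bound_codim (I J K r : nat) : (0 < K)%N ->
  let m : int := r%:Z - K%:Z + 2 in
  [/\ m - 1 <= I%:Z, (I <= J)%N, (J <= K)%N, (K <= r)%N &
      r%:Z <= (I%:Z + 1 - m) * (J%:Z + 1 - m) + m - 2] <-> codim_bound I J K r.
Proof.
move=> K0 m; rewrite /codim_bound.
split=> [[mI IJ JK Kr rB]|[IJ JK Kr rI KB]].
  have [x rE] : exists x, r = (K + x)%N by exists (r - K)%N; rewrite subnKC.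
  have mE : m = x%:Z + 2 by rewrite /m rE; lia.
  have -> : (r - K = x)%N by lia.
  have [[a IE] [b JE]] :
      (exists a, I = x.+1 + a)%N /\ (exists b, J = x.+1 + b)%N.
    by split; [exists (I - x.+1)%N | exists (J - x.+1)%N]; lia.
  have ab : K%:Z <= a%:Z * b%:Z.
    have -> : a%:Z = I%:Z + 1 - m by lia.
    have -> : b%:Z = J%:Z + 1 - m by lia.
    by move: rB; set c := _ * _; lia.
  split=> //; nia.
have [x rE] : exists x, r = (K + x)%N by exists (r - K)%N; rewrite subnKC.
have mE : m = x%:Z + 2 by rewrite /m rE; lia.
have xE : (r - K = x)%N by lia.
rewrite xE in rI KB.
split=> //; first by lia.
have -> : I%:Z + 1 - m = (I - x.+1)%N%:Z by lia.
have -> : J%:Z + 1 - m = (J - x.+1)%N%:Z by lia.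
move: KB; set c := (_ * _)%N => KB; rewrite -PoszM -/c; lia.
Qed.

(** With [x = r - K] and [t = I + J - 2 - 2 * x] the bound reads [sqrt D <= t],
    that is [0 <= t] and [D <= t ^ 2], and [t ^ 2 - D] is four times
    [(I - 1 - x) * (J - 1 - x) - K]. *)
Lemma sqrt_bound_codim (R : realType) (I J K r : nat) : (0 < K)%N ->
  [/\ (2 <= I)%N, (I <= J)%N, (J <= K)%N, (K <= r)%N &
      (r%:R : R) <= (I%:R + J%:R + 2 * K%:R - 2
        - Num.sqrt ((I%:R - J%:R) ^+ 2 + 4 * K%:R)) / 2] <->
  codim_bound I J K r.
Proof.
move=> K0; rewrite /codim_bound.
have K0' : (0 : R) < K%:R by rewrite ltr0n.
set D : R := _ ^+ 2 + _.
have D0 : 0 <= D by rewrite /D addr_ge0 ?sqr_ge0 ?mulr_ge0 ?ler0n.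
split=> [[I2 IJ JK Kr rB]|[IJ JK Kr rI KB]].
  have [x rE] : exists x, r = (K + x)%N by exists (r - K)%N; rewrite subnKC.
  have -> : (r - K = x)%N by lia.
  pose t : R := I%:R + J%:R - 2 - 2 * x%:R.
  have st : Num.sqrt D <= t by move: rB; rewrite rE natrD /t; lra.
  have t0 : 0 <= t := le_trans (sqrtr_ge0 D) st.
  have Dt : D <= t ^+ 2 by rewrite -[D]sqr_sqrtr// lerXn2r ?nnegrE ?sqrtr_ge0.
  have prod : K%:R <= (I%:R - (x%:R + 1)) * (J%:R - (x%:R + 1)) :> R.
    by move: Dt; rewrite /D /t; nra.
  have IJ' : I%:R <= J%:R :> R by rewrite ler_nat.
  have xI : (x.+1 < I)%N.
    rewrite ltnNge; apply/negP; rewrite -(ler_nat R) -natr1 => Ix.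
    by move: t0; rewrite /t; nra.
  split=> //; have xJ := leq_trans xI IJ.
  by rewrite -(ler_nat R) natrM !natrB ?(ltnW xI) ?(ltnW xJ)// -natr1.
have [x rE] : exists x, r = (K + x)%N by exists (r - K)%N; rewrite subnKC.
have xE : (r - K = x)%N by lia.
rewrite xE in rI KB; split=> //; first by lia.
have rJ := leq_trans rI IJ.
have prod : K%:R <= (I%:R - (x%:R + 1)) * (J%:R - (x%:R + 1)) :> R.
  by move: KB; rewrite -(ler_nat R) natrM !natrB ?(ltnW rI) ?(ltnW rJ)// -natr1.
have xI : x%:R + 1 <= I%:R :> R by rewrite natr1 ler_nat ltnW.
have xJ : x%:R + 1 <= J%:R :> R by rewrite natr1 ler_nat ltnW.
pose t : R := I%:R + J%:R - 2 - 2 * x%:R.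
have t0 : 0 <= t by rewrite /t; lra.
have st : Num.sqrt D <= t.
  rewrite -[t]ger0_norm// -sqrtr_sqr ler_wsqrtr// /D /t; nra.
by move: st; rewrite rE natrD /t; lra.
Qed.

(** * Generic uniqueness *)
Lemma thin_negligible_real (R : realType) I J K r
    (P : set ('M[R]_(I, r) * 'M[R]_(J, r) * 'M[R]_(K, r)))
    (X : ('I_I * 'I_r + 'I_J * 'I_r + 'I_K * 'I_r -> R) -> Prop) :
  thin X -> (forall ABC, P ABC -> X (params ABC)) ->
  (factor_matrices_measure (@lebesgue_measure R) I J K r).-negligible P.
Proof.
move=> [f [pf [y fy] f0]] PX.
have nx := polynull_factor_matrices I J K r (polynull_lebesgue R).
apply: (negligible_zero_set (f := fun y => f (fun v => y (v, tt))) nx).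
- by apply: polyfun_comp => // v; exact: polyfun_var.
- by exists (fun vw => y vw.1).
- by move=> ABC /PX/f0.
Qed.

Lemma thin_negligible_complex (R : realType) I J K r
    (P : set ('M[R[i]]_(I, r) * 'M[R[i]]_(J, r) * 'M[R[i]]_(K, r)))
    (X : ('I_I * 'I_r + 'I_J * 'I_r + 'I_K * 'I_r -> R[i]) -> Prop) :
  thin X -> (forall ABC, P ABC -> X (params ABC)) ->
  (factor_matrices_measure (@complex_lebesgue_measure R) I J K r).-negligible P.
Proof.
move=> [f [pf [y fy] f0]] PX.
have nx := polynull_factor_matrices I J K r (polynull_complex R).
have [u [v [pu pv fE]]] := polyfun_complex pf.
have fP ABC : P ABC -> f (params ABC) = 0 by move=> /PX/f0.
(* at a point where [f] is nonzero, one of its two parts is nonzero *)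
have [u0|u0] := eqVneq (u (fun vb => complex_coord (y vb.1) vb.2)) 0.
  apply: (negligible_zero_set nx pv).
    eexists; apply: contraNneq fy => v0; rewrite fE u0; apply/eqP.
    congr (Complex _ _).
    exact: v0.
  by move=> ABC /fP; rewrite fE => -[].
apply: (negligible_zero_set nx pu); first by eexists; exact: u0.
by move=> ABC /fP; rewrite fE => -[].
Qed.

Lemma cpd_not_unique_degenerate (F : numFieldType) I J K r ABC :
  (0 < K)%N -> codim_bound I J K r -> @cpd_not_unique F I J K r ABC ->
  ~ [/\ general_position (matA (params ABC)),
    general_position (matB (params ABC)), general_position (matC (params ABC)) &
    low_rank_trivial (matA (params ABC)) (matB (params ABC))
      (matC (params ABC))].
Proof.
move=> K0 [IJ JK Kr rI KB] nu; apply: contra_not nu => -[gA gB gC lrt].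
have -> : ABC = (matA (params ABC), matB (params ABC), matC (params ABC)).
  case: ABC {gA gB gC lrt} => [[A B] C].
  by congr (_, _, _); apply/matrixP => i q; rewrite mxE.
by apply: cpd_unique_of_general => //=; lia.
Qed.

Theorem proposition1p6 (R : realType) (I J K r : nat)
    (I_gt0 : (0 < I)%N) (J_gt0 : (0 < J)%N) (K_gt0 : (0 < K)%N)
    (r_gt0 : (0 < r)%N) :
  let m : int := r%:Z - K%:Z + 2 in
  let sqrt_bound : Prop :=
    [/\ (2 <= I)%N, (I <= J)%N, (J <= K)%N, (K <= r)%N &
      (r%:R : R) <= (I%:R + J%:R + 2 * K%:R - 2
        - Num.sqrt ((I%:R - J%:R) ^+ 2 + 4 * K%:R)) / 2] in
  let m_bound : Prop :=
    [/\ m - 1 <= I%:Z, (I <= J)%N, (J <= K)%N, (K <= r)%N &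
      r%:Z <= (I%:Z + 1 - m) * (J%:Z + 1 - m) + m - 2] in
  (sqrt_bound <-> m_bound) /\
  (sqrt_bound ->
    generically_unique_cpd_real R I J K r /\
    generically_unique_cpd_complex R I J K r).
Proof.
move=> m sqrt_bound m_bound.
have sb : sqrt_bound <-> codim_bound I J K r by exact: sqrt_bound_codim.
have mb : m_bound <-> codim_bound I J K r by exact: int_bound_codim.
split; first by rewrite sb mb.
move=> /sb cb; have [IJ JK Kr rI KB] := cb.
have deg (F : numFieldType) := @thin_degenerate F I J K r.
split.
  apply: (thin_negligible_real (deg R _ _ _ _ _ _)); try lia.
  by move=> ABC; exact: cpd_not_unique_degenerate.
apply: (thin_negligible_complex (deg R[i] _ _ _ _ _ _)); try lia.
by move=> ABC; exact: cpd_not_unique_degenerate.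
Qed.
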